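(* Let $A$ be a brick gentle algebra. There is a bijection between $\mathrm{torshad}(\Pi(A))$ and $\mathrm{widshad}(\Pi(A))$.
   Context: Setting: $k$ a field, $A=kQ/I$, $Q$ finite connected quiver, $I$ admissible generated by paths (paths composed right to left). Gentle: (S1) each vertex has at most two incoming and two outgoing arrows; (S2) for each arrow $\alpha$ at most one $\beta$ with $\alpha\beta$ a path not in $I$ and at most one $\gamma$ with $\gamma\alpha$ a path not in $I$; (G1) $I$ generated by paths of length two; (G2) for each arrow $\alpha$ at most one $\beta$ with $\alpha\beta$ a path in $I$ and at most one $\gamma$ with $\gamma\alpha$ a path in $I$. Brick gentle: moreover every indecomposable module has endomorphism ring a division ring. Strings (for any $k\Gamma/J$, $J$ generated by paths): words $w=\gamma_d^{\epsilon_d}\cdots\gamma_1^{\epsilon_1}$ in arrows and formal inverses ($s(\gamma^{-1})=t(\gamma)$, $t(\gamma^{-1})=s(\gamma)$), consecutive letters composable, no $\gamma\gamma^{-1}$ or $\gamma^{-1}\gamma$, neither $w$ nor $w^{-1}$ containing a subword which is a path in $J$; plus length-zero strings; $w\sim w^{-1}$. String module $M(w)$: basis $b_1,\dots,b_{d+1}$, $b_j$ at vertex $x_j$ ($x_1=s(\gamma_1^{\epsilon_1})$, $x_{i+1}=t(\gamma_i^{\epsilon_i})$); $\gamma_i$ sends $b_i\mapsto b_{i+1}$ if $\epsilon_i=1$, $b_{i+1}\mapsto b_i$ if $\epsilon_i=-1$, other actions zero. $\Pi(A)=k\overline Q/\overline I$: $\overline Q$ has vertices $Q_0$ and arrows $Q_1$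 together with $\gamma^*:t(\gamma)\to s(\gamma)$ for each $\gamma\in Q_1$; $\overline I$ generated by $\beta\alpha,\alpha^*\beta^*$ for all paths $\beta\alpha\in I$ of length two. A string of $\Pi(A)$ specializes to the word obtained by replacing $\gamma^*$ by $\gamma^{-1}$ and $(\gamma^* )^{-1}$ by $\gamma$. $\mathcal M\subseteq\mathrm{mod}(\Pi(A))$ is the additive closure of all string modules $M(\widetilde w)$ with $\widetilde w$ a string of $\Pi(A)$ specializing to a string of $A$. $\mathrm{torshad}(\Pi(A))$ is the set of $\mathcal T\cap\mathcal M$ with $\mathcal T$ a torsion class (subcategory closed under quotients and extensions) of $\mathrm{mod}(\Pi(A))$; $\mathrm{widshad}(\Pi(A))$ is the set of $\mathcal W\cap\mathcal M$ with $\mathcal W$ a wide subcategory (abelian, closed under extensions) of $\mathrm{mod}(\Pi(A))$. *)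

(* Defs.v *)
From HB Require Import structures.
From mathcomp Require Import all_boot all_order all_algebra.
Set Implicit Arguments. Unset Strict Implicit. Unset Printing Implicit Defensive.
Import GRing.Theory.
Local Open Scope ring_scope.

(* A finite quiver with a set of relations of length two.
   [rel a b] means: the path "b a" (first a, then b; paths composed right to
   left) is one of the generators of the ideal. *)
Record bquiver := BQuiver {
  vtx : finType;
  arr : finType;
  src : arr -> vtx;
  tgt : arr -> vtx;
  rel : arr -> arr -> bool }.

Section Quiver.
Variable Q : bquiver.

Definition paths_of_length (n : nat) (p : seq (arr Q)) : Prop :=
  size p = n /\ forall p1 p2 a b, p = p1 ++ a :: b :: p2 -> tgt a = src b.

Definition contains_rel (p : seq (arr Q)) : Prop :=
  exists p1 p2 a b, p = p1 ++ a :: b :: p2 /\ @rel Q a b.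

Definition admissible_rel : Prop :=
  (forall a b, @rel Q a b -> tgt a = src b) /\
  exists N, forall p, paths_of_length N p -> contains_rel p.

Definition adj (v w : vtx Q) : bool :=
  [exists a, ((src a == v) && (tgt a == w)) || ((src a == w) && (tgt a == v))].

Definition connected_quiver : Prop := forall v w : vtx Q, connect adj v w.

Definition gentle : Prop :=
  [/\ admissible_rel, connected_quiver,
   forall v : vtx Q, #|[set a | tgt a == v]| <= 2 /\ #|[set a | src a == v]| <= 2,
   forall a, #|[set b | (tgt b == src a) && ~~ @rel Q b a]| <= 1 /\
             #|[set c | (tgt a == src c) && ~~ @rel Q a c]| <= 1 &
   forall a, #|[set b | (tgt b == src a) && @rel Q b a]| <= 1 /\
             #|[set c | (tgt a == src c) && @rel Q a c]| <= 1]%N.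

(* Strings.  A letter is (a, true) = a, or (a, false) = a^{-1}.
   A string is a start vertex x together with the word listed in the order
   of application [gamma_1^e_1; ...; gamma_d^e_d]. *)
Definition letter := (arr Q * bool)%type.
Definition lsrc (l : letter) : vtx Q := if l.2 then src l.1 else tgt l.1.
Definition ltgt (l : letter) : vtx Q := if l.2 then tgt l.1 else src l.1.

Definition string_step (l1 l2 : letter) : Prop :=
  [/\ ltgt l1 = lsrc l2,
      ~ (l1.1 = l2.1 /\ l1.2 <> l2.2),
      ~ (l1.2 /\ l2.2 /\ @rel Q l1.1 l2.1) &
      ~ (~~ l1.2 /\ ~~ l2.2 /\ @rel Q l2.1 l1.1)].

Definition is_string (x : vtx Q) (w : seq letter) : Prop :=
  (forall l w', w = l :: w' -> lsrc l = x) /\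
  (forall w1 w2 l1 l2, w = w1 ++ l1 :: l2 :: w2 -> string_step l1 l2).

End Quiver.

(* Finite-dimensional (right) modules over kQ/I: a vector space k^n (row
   vectors) with complete orthogonal idempotents e_v and arrow actions. *)
Record rmod (k : fieldType) (Q : bquiver) := RMod {
  mdim : nat;
  midem : vtx Q -> 'M[k]_mdim;
  mact : arr Q -> 'M[k]_mdim }.

Section Modules.
Variables (k : fieldType) (Q : bquiver).

Definition is_module (X : rmod k Q) : Prop :=
  [/\ forall v, midem X v *m midem X v = midem X v,
      forall v w, v != w -> midem X v *m midem X w = 0,
      \sum_v midem X v = 1%:M,
      forall a, mact X a = midem X (src a) *m mact X a *m midem X (tgt a) &
      forall a b, @rel Q a b -> mact X a *m mact X b = 0].

Definition is_hom (X Y : rmod k Q) (f : 'M[k]_(mdim X, mdim Y)) : Prop :=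
  (forall v, midem X v *m f = f *m midem Y v) /\
  (forall a, mact X a *m f = f *m mact Y a).

Definition iso (X Y : rmod k Q) : Prop :=
  exists f : 'M[k]_(mdim X, mdim Y), [/\ is_hom f, row_free f & row_full f].

Definition zero_mod : rmod k Q := @RMod k Q 0 (fun _ => 0) (fun _ => 0).

Definition dsum (X Y : rmod k Q) : rmod k Q :=
  @RMod k Q (mdim X + mdim Y)
    (fun v => block_mx (midem X v) 0 0 (midem Y v))
    (fun a => block_mx (mact X a) 0 0 (mact Y a)).

Definition bigsum (s : seq (rmod k Q)) : rmod k Q := foldr dsum zero_mod s.

Definition indecomposable (X : rmod k Q) : Prop :=
  [/\ is_module X, (0 < mdim X)%N &
      ~ exists Y Z, [/\ is_module Y, is_module Z, (0 < mdim Y)%N,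
                        (0 < mdim Z)%N & iso X (dsum Y Z)]].

Definition brick_algebra : Prop :=
  forall X : rmod k Q, indecomposable X ->
    forall f : 'M[k]_(mdim X), is_hom f -> f != 0 -> f \in unitmx.

(* String module M(w) with basis b_0..b_d, b_j at vertex x_j. *)
Definition svert (x : vtx Q) (w : seq (letter Q)) (j : nat) : vtx Q :=
  nth x (x :: map (@ltgt Q) w) j.

Definition smod (x : vtx Q) (w : seq (letter Q)) : rmod k Q :=
  @RMod k Q (size w).+1
    (fun v => \matrix_(p, q) ((p == q) && (svert x w p == v))%:R)
    (fun a => \matrix_(p, q)
       ((((val p < size w)%N && (val q == (val p).+1) &&
            (nth (a, true) w p == (a, true))) ||
         ((val q < size w)%N && (val p == (val q).+1) &&
            (nth (a, false) w q == (a, false))))%:R)).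

Definition short_exact (L X N : rmod k Q) (f : 'M[k]_(mdim L, mdim X))
    (g : 'M[k]_(mdim X, mdim N)) : Prop :=
  [/\ row_free f, row_full g, f *m g = 0 & (\rank f + \rank g)%N = mdim X].

Definition torsion_class (T : rmod k Q -> Prop) : Prop :=
  [/\ T zero_mod,
      forall X Y (f : 'M[k]_(mdim X, mdim Y)),
        is_module X -> is_module Y -> is_hom f -> row_full f -> T X -> T Y &
      forall L X N (f : 'M[k]_(mdim L, mdim X)) (g : 'M[k]_(mdim X, mdim N)),
        is_module L -> is_module X -> is_module N -> is_hom f -> is_hom g ->
        short_exact f g -> T L -> T N -> T X].

Definition wide_subcat (W : rmod k Q -> Prop) : Prop :=
  [/\ W zero_mod,
      forall X Y (f : 'M[k]_(mdim X, mdim Y)),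
        is_module X -> is_module Y -> is_hom f -> row_free f -> row_full f ->
        W X -> W Y,
      forall X Y K (f : 'M[k]_(mdim X, mdim Y)) (i : 'M[k]_(mdim K, mdim X)),
        is_module X -> is_module Y -> is_module K -> is_hom f -> is_hom i ->
        row_free i -> i *m f = 0 -> (\rank i + \rank f)%N = mdim X ->
        W X -> W Y -> W K,
      forall X Y C (f : 'M[k]_(mdim X, mdim Y)) (c : 'M[k]_(mdim Y, mdim C)),
        is_module X -> is_module Y -> is_module C -> is_hom f -> is_hom c ->
        row_full c -> f *m c = 0 -> (\rank f + \rank c)%N = mdim Y ->
        W X -> W Y -> W C &
      forall L X N (f : 'M[k]_(mdim L, mdim X)) (g : 'M[k]_(mdim X, mdim N)),
        is_module L -> is_module X -> is_module N -> is_hom f -> is_hom g ->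
        short_exact f g -> W L -> W N -> W X].

End Modules.

(* The preprojective-like algebra Pi(A): arrows inl a = a, inr a = a^*. *)
Definition piQ (Q : bquiver) : bquiver :=
  @BQuiver (vtx Q) (arr Q + arr Q)%type
    (fun e => match e with inl a => src a | inr a => tgt a end)
    (fun e => match e with inl a => tgt a | inr a => src a end)
    (fun e1 e2 => match e1, e2 with
                  | inl a, inl b => @rel Q a b
                  | inr b, inr a => @rel Q a b
                  | _, _ => false end).

Definition spec (Q : bquiver) (l : letter (piQ Q)) : letter Q :=
  match l.1 with inl a => (a, l.2) | inr a => (a, ~~ l.2) end.

Section Shadows.
Variables (k : fieldType) (Q : bquiver).

Definition inM (X : rmod k (piQ Q)) : Prop :=
  is_module X /\
  exists s : seq (vtx Q * seq (letter (piQ Q))),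
    (forall p, p \in s ->
       is_string (Q := piQ Q) p.1 p.2 /\ is_string (Q := Q) p.1 (map (@spec Q) p.2)) /\
    iso X (bigsum [seq @smod k (piQ Q) p.1 p.2 | p <- s]).

Definition torshad (P : rmod k (piQ Q) -> Prop) : Prop :=
  exists T, torsion_class T /\ P = (fun X => T X /\ inM X).

Definition widshad (P : rmod k (piQ Q) -> Prop) : Prop :=
  exists W, wide_subcat W /\ P = (fun X => W X /\ inM X).

End Shadows.

(* Main.v *)
From mathcomp Require Import all_boot all_order all_algebra.
From mathcomp Require Import zify.
From Stdlib Require Import ClassicalEpsilon.
From Stdlib Require Import FunctionalExtensionality PropExtensionality ProofIrrelevance.
Require Import Defs.
Set Implicit Arguments. Unset Strict Implicit. Unset Printing Implicit Defensive.
Import GRing.Theory.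
Local Open Scope ring_scope.

(* Both kinds of shadows are parametrized by the sets S of string modules from M
   that are semibricks (nonzero maps between members are isomorphisms): send S to
   T(S) ∩ M and to W(S) ∩ M, where T(S) and W(S) are the torsion class and the wide
   subcategory generated by S.

   Injectivity.  If T(S) = T(S') and X is in S, there are nonzero maps
   S_1 -> S'_1 -> X with S_1 in S and S'_1 in S'; maps from T(S) to members of S are
   zero or onto, so the composite is an isomorphism and X = S'_1.  The wide case
   reduces to this one: W(S) lies in T(S), because T(S) contains the wide
   subcategory of those Y for which every map Z -> Y with Z in T(S) has its kernel
   in T(S), and S consists of such modules.

   Surjectivity.  In a brick gentle algebra a string visits each vertex at most
   once: a repeated vertex gives a closed walk, hence a string module with a nonzero
   nilpotent endomorphism but local endomorphism ring.  So string modules in M are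
   thin, a map between two of them is diagonal, and its kernel, image and cokernel
   are spanned by basis vectors, hence lie in M.  This makes it possible to break up
   the modules of a shadow inside M until only a semibrick is left. *)

(** * Exact pairs of matrices; kernels, images and quotients of modules *)

Section Exactness.
Variable k : fieldType.

(** Vectors are rows, so this says that the image of [f] is the kernel of [c]. Stated as a boolean
    equation for matrices of any height, it rewrites single vectors and whole maps alike. *)
Definition exact n1 n n2 (f : 'M[k]_(n1, n)) (c : 'M[k]_(n, n2)) :=
  forall m (v : 'M_(m, n)), (v <= f)%MS = (v *m c == 0).

Lemma exact_kermx n n2 (c : 'M[k]_(n, n2)) : exact (kermx c) c.
Proof. by move=> m v; rewrite sub_kermx. Qed.

Lemma exact_mul0 n1 n n2 (f : 'M[k]_(n1, n)) (c : 'M[k]_(n, n2)) :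
  exact f c -> f *m c = 0.
Proof. by move=> e; apply/eqP; rewrite -e. Qed.

Lemma exactI n1 n n2 (f : 'M[k]_(n1, n)) (c : 'M[k]_(n, n2)) :
  f *m c = 0 -> (forall v : 'rV_n, v *m c = 0 -> (v <= f)%MS) -> exact f c.
Proof.
move=> fc0 H m v; apply/idP/eqP => [/submxP[u ->]|vc0].
  by rewrite -mulmxA fc0 mulmx0.
by apply/row_subP => i; apply: H; rewrite -row_mul vc0 row0.
Qed.

Lemma exact_rank n1 n n2 (f : 'M[k]_(n1, n)) (c : 'M[k]_(n, n2)) :
  exact f c -> (\rank f + \rank c)%N = n.
Proof.
move=> e; have -> : \rank f = \rank (kermx c).
  apply/eqP; rewrite eqn_leq; apply/andP; split; apply: mxrankS.
    by rewrite sub_kermx (exact_mul0 e).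
  by rewrite e mulmx_ker.
by rewrite mxrank_ker subnK // rank_leq_row.
Qed.

(** Torsion classes and wide subcategories are defined by a rank condition; together with
    [exact_rank] this translates it. An image inside the kernel and of the same dimension is the
    kernel. *)
Lemma exact_of_rank n1 n n2 (f : 'M[k]_(n1, n)) (c : 'M[k]_(n, n2)) :
  f *m c = 0 -> (\rank f + \rank c)%N = n -> exact f c.
Proof.
move=> fc0 r.
have s : (f <= kermx c)%MS by rewrite sub_kermx fc0.
have := mxrank_leqif_eq s; rewrite mxrank_ker => -[_].
have -> : (n - \rank c)%N = \rank f by rewrite -[X in (X - _)%N]r addnK.
rewrite eqxx => /esym/eqmxP e m v.
by rewrite e sub_kermx.
Qed.

Lemma row_free_mulr0 m n p (u : 'M[k]_(m, n)) (f : 'M_(n, p)) :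
  row_free f -> u *m f = 0 -> u = 0.
Proof. by move=> ff /eqP; rewrite mulmx_free_eq0 // => /eqP. Qed.

Lemma row_full_mull0 m n p (u : 'M[k]_(n, p)) (f : 'M_(m, n)) :
  row_full f -> f *m u = 0 -> u = 0.
Proof. by move=> ff h; apply: (row_full_inj ff); rewrite h mulmx0. Qed.

Lemma row_full_mul m n p (f : 'M[k]_(m, n)) (g : 'M_(n, p)) :
  row_full f -> row_full g -> row_full (f *m g).
Proof.
move=> /row_fullP[f' hf] /row_fullP[g' hg]; apply/row_fullP.
by exists (g' *m f'); rewrite mulmxA -(mulmxA g') hf mulmx1.
Qed.

Lemma row_free_mul m n p (f : 'M[k]_(m, n)) (g : 'M_(n, p)) :
  row_free f -> row_free g -> row_free (f *m g).
Proof.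
move=> /row_freeP[f' hf] /row_freeP[g' hg]; apply/row_freeP.
by exists (g' *m f'); rewrite mulmxA -(mulmxA f) hg mulmx1.
Qed.

Lemma row_full_mulr m n p (f : 'M[k]_(m, n)) (g : 'M_(n, p)) :
  row_full (f *m g) -> row_full g.
Proof. by move=> /row_fullP[h hf]; apply/row_fullP; exists (h *m f); rewrite -mulmxA. Qed.

Lemma row_free_mull m n p (f : 'M[k]_(m, n)) (g : 'M_(n, p)) :
  row_free (f *m g) -> row_free f.
Proof. by move=> /row_freeP[h hf]; apply/row_freeP; exists (g *m h); rewrite mulmxA. Qed.

End Exactness.

Section Modules.
Variables (k : fieldType) (Q : bquiver).
Implicit Types X Y Z K C L N : rmod k Q.

Lemma hom1 X : @is_hom k Q X X 1%:M.
Proof. by split=> ?; rewrite mulmx1 mul1mx. Qed.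

Lemma hom_mul X Y Z (f : 'M_(mdim X, mdim Y)) (g : 'M_(mdim Y, mdim Z)) :
  is_hom f -> is_hom g -> is_hom (f *m g).
Proof.
by move=> [f1 f2] [g1 g2]; split=> a; rewrite mulmxA ?f1 ?f2 -mulmxA ?g1 ?g2 mulmxA.
Qed.

Lemma hom0 X Y : @is_hom k Q X Y 0.
Proof. by split=> a; rewrite mulmx0 mul0mx. Qed.

Lemma homB X Y (f g : 'M_(mdim X, mdim Y)) :
  is_hom f -> is_hom g -> is_hom (f - g).
Proof. by move=> [f1 f2] [g1 g2]; split=> a; rewrite mulmxBl mulmxBr ?f1 ?f2 ?g1 ?g2. Qed.

(** The pseudo-inverse gives a linear factorization. Since [i] is injective it can be cancelled on
    the right, and this makes the factor commute with the actions. *)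
Lemma hom_factor_sub K X Z (i : 'M_(mdim K, mdim X)) (h : 'M_(mdim Z, mdim X)) :
  is_hom i -> row_free i -> is_hom h -> (h <= i)%MS ->
  exists g : 'M_(mdim Z, mdim K), is_hom g /\ g *m i = h.
Proof.
move=> [i1 i2] fi [h1 h2] s; exists (h *m pinvmx i); have e := mulmxKpV s.
split=> //; split=> a; apply: (row_free_inj fi).
  by rewrite -mulmxA e -mulmxA i1 mulmxA e h1.
by rewrite -mulmxA e -mulmxA i2 mulmxA e h2.
Qed.

Lemma hom_factor_quo X C Z (c : 'M_(mdim X, mdim C)) (h : 'M_(mdim X, mdim Z)) :
  is_hom c -> row_full c -> is_hom h -> (kermx c <= kermx h)%MS ->
  exists g : 'M_(mdim C, mdim Z), is_hom g /\ c *m g = h.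
Proof.
move=> [c1 c2] fc [h1 h2] s.
have e : c *m (pinvmx c *m h) = h.
  apply/eqP; rewrite -subr_eq0 mulmxA -[X in _ - X]mul1mx -mulmxBl -sub_kermx.
  apply: submx_trans s; rewrite sub_kermx mulmxBl -mulmxA mulVpmx //.
  by rewrite mulmx1 mul1mx subrr.
exists (pinvmx c *m h); split=> //; split=> a; apply: (row_full_inj fc).
  by rewrite mulmxA -c1 -mulmxA e h1 mulmxA e.
by rewrite mulmxA -c2 -mulmxA e h2 mulmxA e.
Qed.

Definition stable X m (U : 'M_(m, mdim X)) :=
  (forall v, (U *m midem X v <= U)%MS) /\ (forall a, (U *m mact X a <= U)%MS).

(** A basis [i] of the row space carries the restricted action [i *m M *m pinvmx i]; the module
    axioms are checked after cancelling [i] on the right. *)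
Lemma sub_ex X m (U : 'M_(m, mdim X)) : is_module X -> stable U ->
  exists K (i : 'M_(mdim K, mdim X)),
    [/\ is_module K, is_hom i, row_free i & (i :=: U)%MS].
Proof.
move=> [m1 m2 m3 m4 m5] [s1 s2].
pose i := row_base U.
have fi : row_free i by apply: row_base_free.
have ei : (i :=: U)%MS by apply: eq_row_base.
pose K := @RMod k Q (\rank U) (fun v => i *m midem X v *m pinvmx i)
                              (fun a => i *m mact X a *m pinvmx i).
have e1 v : i *m midem X v *m pinvmx i *m i = i *m midem X v.
  by apply: mulmxKpV; rewrite (eqmxMr _ ei) ei s1.
have e2 a : i *m mact X a *m pinvmx i *m i = i *m mact X a.
  by apply: mulmxKpV; rewrite (eqmxMr _ ei) ei s2.
exists K, i; split=> //.
split=> /=.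
- by move=> v; apply: (row_free_inj fi); rewrite -mulmxA e1 mulmxA e1 -mulmxA m1.
- move=> v w vw; apply: (row_free_inj fi); rewrite -mulmxA e1 mulmxA e1 -mulmxA m2 //.
  by rewrite mulmx0 mul0mx.
- by rewrite -mulmx_suml -mulmx_sumr m3 mulmx1 mulmxVp.
- move=> a; apply: (row_free_inj fi).
  rewrite e2 -[in RHS]mulmxA e1 [in RHS]mulmxA -(mulmxA _ _ i) e2 (mulmxA _ i) e1.
  by rewrite [in LHS]m4 !mulmxA.
- move=> a b ab; apply: (row_free_inj fi).
  by rewrite -mulmxA e2 mulmxA e2 -mulmxA m5 // mulmx0 mul0mx.
Qed.

(** Dual to [sub_ex]: the quotient map comes from a full-rank factorization of [cokermx U], and the
    axioms are checked after cancelling the surjection [c] on the left. *)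
Lemma quo_ex X m (U : 'M_(m, mdim X)) : is_module X -> stable U ->
  exists C (c : 'M_(mdim X, mdim C)),
    [/\ is_module C, is_hom c, row_full c & exact U c].
Proof.
move=> [m1 m2 m3 m4 m5] [s1 s2].
pose c := col_base (cokermx U).
have fc : row_full c by apply: col_base_full.
have ec : exact U c.
  move=> p v; rewrite submxE -[X in v *m X](mulmx_base (cokermx U)) mulmxA.
  by rewrite mulmx_free_eq0 // row_base_free.
pose q M := pinvmx c *m M *m c.
pose C := @RMod k Q (\rank (cokermx U)) (fun v => q (midem X v)) (fun a => q (mact X a)).
have eq M : (U *m M <= U)%MS -> c *m q M = M *m c.
  move=> s; have : ((c *m pinvmx c - 1%:M) *m M <= U)%MS.
    apply: submx_trans s; apply: submxMr.
    by rewrite ec mulmxBl -mulmxA mulVpmx // mulmx1 mul1mx subrr.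
  by rewrite ec !mulmxBl mul1mx subr_eq0 /q !mulmxA => /eqP.
have e1 v := eq _ (s1 v); have e2 a := eq _ (s2 a).
exists C, c; split=> //; last by split=> a /=; rewrite ?e1 ?e2.
split=> /=.
- by move=> v; apply: (row_full_inj fc); rewrite mulmxA e1 -mulmxA e1 mulmxA m1.
- move=> v w vw; apply: (row_full_inj fc).
  by rewrite mulmxA e1 -mulmxA e1 mulmxA m2 // mul0mx mulmx0.
- by rewrite /q -mulmx_suml -mulmx_sumr m3 mulmx1 mulVpmx.
- move=> a; apply: (row_full_inj fc).
  rewrite [in LHS]e2 -[in RHS]mulmxA [in RHS]mulmxA e1 -[in RHS]mulmxA (mulmxA c) e2.
  by rewrite -(mulmxA _ c) e1 !mulmxA [in LHS]m4.
- move=> a b ab; apply: (row_full_inj fc).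
  by rewrite mulmxA e2 -mulmxA e2 mulmxA m5 // mul0mx mulmx0.
Qed.

Lemma stable_ker X Y (f : 'M_(mdim X, mdim Y)) : is_hom f -> stable (kermx f).
Proof.
by move=> [f1 f2]; split=> a; rewrite sub_kermx -mulmxA ?f1 ?f2 mulmxA mulmx_ker mul0mx.
Qed.

Lemma stable_im X Y (f : 'M_(mdim X, mdim Y)) : is_hom f -> @stable Y _ f.
Proof. by move=> [f1 f2]; split=> a; rewrite -?f1 -?f2 submxMl. Qed.

Lemma ker_ex X Y (f : 'M_(mdim X, mdim Y)) : is_module X -> is_hom f ->
  exists K (i : 'M_(mdim K, mdim X)),
    [/\ is_module K, is_hom i, row_free i & exact i f].
Proof.
move=> mX hf; have [K [i [mK hi fi ei]]] := sub_ex mX (stable_ker hf).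
by exists K, i; split=> // m v; rewrite ei exact_kermx.
Qed.

Lemma coker_ex X Y (f : 'M_(mdim X, mdim Y)) : is_module Y -> is_hom f ->
  exists C (c : 'M_(mdim Y, mdim C)),
    [/\ is_module C, is_hom c, row_full c & exact f c].
Proof. by move=> mY hf; exact: quo_ex mY (stable_im hf). Qed.

Lemma im_ex X Y (f : 'M_(mdim X, mdim Y)) : is_module Y -> is_hom f ->
  exists I (p : 'M_(mdim X, mdim I)) (j : 'M_(mdim I, mdim Y)),
    [/\ is_module I, is_hom p /\ row_full p, is_hom j /\ row_free j,
       (j :=: f)%MS & p *m j = f].
Proof.
move=> mY hf; have [I [j [mI hj fj ej]]] := sub_ex mY (stable_im hf).
have [p [hp epj]] : exists p : 'M_(mdim X, mdim I), is_hom p /\ p *m j = f.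
  by apply: hom_factor_sub => //; rewrite ej.
exists I, p, j; split=> //; split=> //.
rewrite /row_full -(mxrankMfree p fj) epj -ej.
by move: fj; rewrite /row_free.
Qed.

Lemma hom_inv X Y (f : 'M_(mdim X, mdim Y)) : is_hom f -> row_free f -> row_full f ->
  exists g : 'M_(mdim Y, mdim X), [/\ is_hom g, g *m f = 1%:M & f *m g = 1%:M].
Proof.
move=> hf ff uf.
have [g [hg e]] : exists g : 'M_(mdim Y, mdim X), is_hom g /\ g *m f = 1%:M.
  by apply: hom_factor_sub => //; [exact: hom1 | exact: submx_full].
exists g; split=> //; apply: (row_free_inj ff).
by rewrite -mulmxA e mulmx1 mul1mx.
Qed.

End Modules.

(** * Torsion classes and wide subcategories *)

Section Sums.
Variables (k : fieldType) (Q : bquiver).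
Implicit Types X Y Z K C L N : rmod k Q.

Lemma iso_sym X Y : iso X Y -> iso Y X.
Proof.
move=> [f [hf ff uf]]; have [g [hg gf fg]] := hom_inv hf ff uf.
exists g; split=> //; [apply/row_freeP|apply/row_fullP]; by exists f.
Qed.

Lemma iso_trans X Y Z : iso X Y -> iso Y Z -> iso X Z.
Proof.
move=> [f [hf ff uf]] [g [hg fg ug]]; exists (f *m g).
by split; [exact: hom_mul| exact: row_free_mul | exact: row_full_mul].
Qed.

Lemma iso_dim X Y : iso X Y -> mdim X = mdim Y.
Proof. by move=> [f [_ /eqP e /eqP e']]; rewrite -[LHS]e. Qed.

Lemma zero_module : is_module (zero_mod k Q).
Proof. by split=> *; apply/matrixP => -[]. Qed.

Lemma dsum_module X Y : is_module X -> is_module Y -> is_module (dsum X Y).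
Proof.
move=> [m1 m2 m3 m4 m5] [n1 n2 n3 n4 n5].
split=> [v|v w vw||a|a b ab] /=; rewrite ?mulmx_block ?mulmx0 ?mul0mx ?addr0 ?add0r.
- by rewrite m1 n1.
- by rewrite m2 // n2 // -[RHS]block_mx0 .
- rewrite [RHS]scalar_mx_block -m3 -n3.
  elim: (index_enum _) => [|v s IH]; first by rewrite !big_nil block_mx0.
  by rewrite !big_cons IH add_block_mx !addr0.
- by rewrite ?mulmx_block ?mulmx0 ?mul0mx ?addr0 ?add0r -m4 -n4.
- by rewrite m5 // n5 // -[RHS]block_mx0.
Qed.

Lemma hom_inl X Y : @is_hom k Q X (dsum X Y) (row_mx 1%:M 0).
Proof.
by split=> v /=; rewrite mul_row_block mul_mx_row !mulmx0 !mul0mx mulmx1 mul1mx !addr0.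
Qed.

Lemma hom_inr X Y : @is_hom k Q Y (dsum X Y) (row_mx 0 1%:M).
Proof.
by split=> v /=; rewrite mul_row_block mul_mx_row !mulmx0 !mul0mx mulmx1 mul1mx !add0r.
Qed.

Lemma hom_col X Y Z (f : 'M_(mdim X, mdim Z)) (g : 'M_(mdim Y, mdim Z)) :
  is_hom f -> is_hom g -> @is_hom k Q (dsum X Y) Z (col_mx f g).
Proof.
move=> [f1 f2] [g1 g2]; split=> v /=.
  by rewrite mul_block_col mul_col_mx !mul0mx addr0 add0r f1 g1.
by rewrite mul_block_col mul_col_mx !mul0mx addr0 add0r f2 g2.
Qed.

Lemma hom_row X Y Z (f : 'M_(mdim Z, mdim X)) (g : 'M_(mdim Z, mdim Y)) :
  is_hom f -> is_hom g -> @is_hom k Q Z (dsum X Y) (row_mx f g).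
Proof.
move=> [f1 f2] [g1 g2]; split=> v /=.
  by rewrite mul_row_block mul_mx_row !mulmx0 addr0 add0r f1 g1.
by rewrite mul_row_block mul_mx_row !mulmx0 addr0 add0r f2 g2.
Qed.

Lemma row_mx10_free m n : row_free (row_mx (1%:M : 'M[k]_m) (0 : 'M_(m, n))).
Proof.
by apply/row_freeP; exists (col_mx 1%:M 0); rewrite mul_row_col mulmx1 mul0mx addr0.
Qed.

Lemma row_mx01_free m n : row_free (row_mx (0 : 'M_(m, n)) (1%:M : 'M[k]_m)).
Proof.
by apply/row_freeP; exists (col_mx 0 1%:M); rewrite mul_row_col mulmx1 mulmx0 add0r.
Qed.

Lemma col_mx10_full m n : row_full (col_mx (1%:M : 'M[k]_m) (0 : 'M_(n, m))).
Proof.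
by apply/row_fullP; exists (row_mx 1%:M 0); rewrite mul_row_col mulmx1 mul0mx addr0.
Qed.

Lemma col_mx01_full m n : row_full (col_mx (0 : 'M_(n, m)) (1%:M : 'M[k]_m)).
Proof.
by apply/row_fullP; exists (row_mx 0 1%:M); rewrite mul_row_col mulmx1 mulmx0 add0r.
Qed.

Lemma exact_inl m n :
  exact (row_mx (1%:M : 'M[k]_m) (0 : 'M_(m, n))) (col_mx 0 1%:M).
Proof.
apply: exactI => [|v]; first by rewrite mul_row_col mulmx0 mul0mx addr0.
rewrite -[v]hsubmxK mul_row_col mulmx0 mulmx1 add0r => ->.
by apply/submxP; exists (lsubmx v); rewrite mul_mx_row mulmx1 mulmx0.
Qed.

Definition iso_closed (T : rmod k Q -> Prop) :=
  forall X Y, is_module X -> is_module Y -> iso X Y -> T X -> T Y.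

(** The clause common to torsion classes and wide subcategories, with exactness in place of ranks,
    so that one induction on direct sums serves both. *)
Definition ext_closed (T : rmod k Q -> Prop) :=
  forall L X N (f : 'M[k]_(mdim L, mdim X)) (g : 'M[k]_(mdim X, mdim N)),
    is_module L -> is_module X -> is_module N -> is_hom f -> is_hom g ->
    row_free f -> row_full g -> exact f g -> T L -> T N -> T X.

Lemma ext_dsum T X Y : ext_closed T -> is_module X -> is_module Y ->
  T X -> T Y -> T (dsum X Y).
Proof.
move=> ext mX mY TX TY.
apply: (ext X (dsum X Y) Y (row_mx 1%:M 0) (col_mx 0 1%:M)) => //.
- exact: dsum_module.
- exact: hom_inl.
- by apply: hom_col; [exact: hom0|exact: hom1].
- exact: row_mx10_free.
- exact: col_mx01_full.
- exact: exact_inl.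
Qed.

End Sums.

Section Torsion.
Variables (k : fieldType) (Q : bquiver).
Implicit Types X Y Z K C L N : rmod k Q.
Variable T : rmod k Q -> Prop.
Hypothesis tT : torsion_class T.

Lemma tors0 : T (zero_mod k Q). Proof. by case: tT. Qed.

Lemma tors_quo X Y (f : 'M[k]_(mdim X, mdim Y)) :
  is_module X -> is_module Y -> is_hom f -> row_full f -> T X -> T Y.
Proof. by case: tT => _ H _; exact: H. Qed.

Lemma tors_iso : iso_closed T.
Proof. by move=> X Y mX mY [f [hf _ uf]]; exact: tors_quo hf uf. Qed.

Lemma tors_ext : ext_closed T.
Proof.
case: tT => _ _ H L X N f g mL mX mN hf hg ff ug e; apply: H hf hg _ => //.
by split=> //; [exact: exact_mul0 | exact: exact_rank].
Qed.

Lemma tors_summand X Y : is_module X -> is_module Y -> T (dsum X Y) -> T X /\ T Y.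
Proof.
move=> mX mY TXY; have m := dsum_module mX mY; split.
  apply: (tors_quo m mX _ (col_mx10_full k _ _) TXY).
  by apply: hom_col; [exact: hom1|exact: hom0].
apply: (tors_quo m mY _ (col_mx01_full k _ _) TXY).
by apply: hom_col; [exact: hom0|exact: hom1].
Qed.

End Torsion.

Section Wide.
Variables (k : fieldType) (Q : bquiver).
Implicit Types X Y Z K C L N : rmod k Q.
Variable W : rmod k Q -> Prop.
Hypothesis wW : wide_subcat W.

Lemma wide0 : W (zero_mod k Q). Proof. by case: wW. Qed.

Lemma wide_iso : iso_closed W.
Proof. by move=> X Y mX mY [f [hf ff uf]]; case: wW => _ H _ _ _; exact: H hf ff uf. Qed.

Lemma wide_ker X Y K (f : 'M[k]_(mdim X, mdim Y)) (i : 'M[k]_(mdim K, mdim X)) :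
  is_module X -> is_module Y -> is_module K -> is_hom f -> is_hom i ->
  row_free i -> exact i f -> W X -> W Y -> W K.
Proof.
move=> mX mY mK hf hi fi e; case: wW => _ _ H _ _.
by apply: (H X Y K f i) => //; [exact: exact_mul0 | exact: exact_rank].
Qed.

Lemma wide_coker X Y C (f : 'M[k]_(mdim X, mdim Y)) (c : 'M[k]_(mdim Y, mdim C)) :
  is_module X -> is_module Y -> is_module C -> is_hom f -> is_hom c ->
  row_full c -> exact f c -> W X -> W Y -> W C.
Proof.
move=> mX mY mK hf hi fi e; case: wW => _ _ _ H _.
by apply: (H X Y C f c) => //; [exact: exact_mul0 | exact: exact_rank].
Qed.

Lemma wide_ext : ext_closed W.
Proof.
case: wW => _ _ _ _ H L X N f g mL mX mN hf hg ff ug e; apply: H hf hg _ => //.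
by split=> //; [exact: exact_mul0 | exact: exact_rank].
Qed.

(** The image is the kernel of the cokernel. *)
Lemma wide_im X Y I (p : 'M_(mdim X, mdim I)) (j : 'M_(mdim I, mdim Y)) :
  is_module X -> is_module Y -> is_module I -> is_hom p -> is_hom j ->
  row_full p -> row_free j -> W X -> W Y -> W I.
Proof.
move=> mX mY mI hp hj up fj WX WY.
have hf := hom_mul hp hj.
have [C [c [mC hc uc ec]]] := coker_ex mY hf.
apply: (wide_ker mY mC mI hc hj fj _ WY (wide_coker mX mY mC hf hc uc ec WX WY)).
by move=> m v; rewrite -ec (eqmxMfull _ up).
Qed.

(** Each summand is the image of an idempotent endomorphism of the sum. *)
Lemma wide_summand X Y : is_module X -> is_module Y -> W (dsum X Y) -> W X /\ W Y.
Proof.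
move=> mX mY WXY; have m := dsum_module mX mY; split.
  apply: (@wide_im (dsum X Y) (dsum X Y) X (col_mx 1%:M 0) (row_mx 1%:M 0)) => //.
  - by apply: hom_col; [exact: hom1|exact: hom0].
  - exact: hom_inl.
  - exact: col_mx10_full.
  - exact: row_mx10_free.
apply: (@wide_im (dsum X Y) (dsum X Y) Y (col_mx 0 1%:M) (row_mx 0 1%:M)) => //.
- by apply: hom_col; [exact: hom0|exact: hom1].
- exact: hom_inr.
- exact: col_mx01_full.
- exact: row_mx01_free.
Qed.

End Wide.

(** * Semibricks and the classes they generate *)

Section LeftFinite.
Variables (k : fieldType) (Q : bquiver).
Implicit Types X Y Z K C L N : rmod k Q.

(* The wide subcategory that Ingalls and Thomas attach to a torsion class. *)
Definition wideL (T : rmod k Q -> Prop) Y :=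
  T Y /\ forall Z K (h : 'M[k]_(mdim Z, mdim Y)) (i : 'M[k]_(mdim K, mdim Z)),
    is_module Z -> is_module K -> is_hom h -> is_hom i -> row_free i ->
    exact i h -> T Z -> T K.

Lemma exact_mulfree n1 n n2 n3 (i : 'M[k]_(n1, n)) (h : 'M_(n, n2)) (f : 'M_(n2, n3)) :
  row_free f -> exact i (h *m f) <-> exact i h.
Proof.
by move=> ff; split=> e m v; rewrite e mulmxA (mulmx_free_eq0 _ ff).
Qed.

(** For isomorphic copies and kernels, compose with an injection, which leaves the kernel of a map
    unchanged. Cokernels and extensions need a real argument. *)
Lemma wideL_wide T : torsion_class T -> wide_subcat (wideL T).
Proof.
move=> tT; split.
- split; first exact: tors0.
  move=> Z K h i mZ mK hh hi fi e TZ.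
  have h0 : h = 0 by apply/matrixP => ? [].
  have ui : row_full i by rewrite -sub1mx e h0 mulmx0.
  have [g [hg gi ig]] := hom_inv hi fi ui.
  by apply: (tors_quo tT mZ mK hg _ TZ); apply/row_fullP; exists i.
- move=> X Y f mX mY hf ff uf [TX HX]; split; first exact: (tors_quo tT mX mY hf uf TX).
  have [g [hg gf fg]] := hom_inv hf ff uf.
  move=> Z K h i mZ mK hh hi fi e; apply: (HX Z K (h *m g) i) => //.
    exact: hom_mul.
  by apply/exact_mulfree => //; apply/row_freeP; exists f.
- move=> X Y K f i mX mY mK hf hi fi if0 r [TX HX] [TY HY].
  have e := exact_of_rank if0 r.
  split; first exact: (HY X K f i).
  move=> Z L h j mZ mL hh hj fj ej; apply: (HX Z L (h *m i) j) => //.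
    exact: hom_mul.
  exact/exact_mulfree.
- move=> X Y C f c mX mY mC hf hc uc fc0 r [TX HX] [TY HY].
  have ec := exact_of_rank fc0 r.
  split; first exact: (tors_quo tT mY mC hc uc TY).
  move=> Z L h j mZ mL hh hj fj ej TZ.
  (* The pullback E of Y -> C <- Z is an extension of Z by the image of f, hence
     lies in T, and L is the kernel of E -> Y. *)
  have mYZ := dsum_module mY mZ.
  have hd : @is_hom k Q (dsum Y Z) C (col_mx c (- h)).
    by apply: hom_col => //; rewrite -[- h]sub0r; apply: homB => //; exact: hom0.
  have [E [e [mE he fe ee]]] := ker_ex mYZ hd.
  have hpY : is_hom (e *m (col_mx 1%:M 0 : 'M_(_ + _, mdim Y))).
    by apply: (@hom_mul k Q E (dsum Y Z) Y) => //; apply: hom_col; [exact: hom1|exact: hom0].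
  have hpZ : is_hom (e *m (col_mx 0 1%:M : 'M_(_ + _, mdim Z))).
    by apply: (@hom_mul k Q E (dsum Y Z) Z) => //; apply: hom_col; [exact: hom0|exact: hom1].
  set pY := e *m _ in hpY; set pZ := e *m _ in hpZ.
  have eE : e = row_mx pY pZ.
    rewrite -mul_mx_row -[LHS]mulmx1 scalar_mx_block; congr (_ *m _).
    by rewrite block_mxEh.
  have [I [p [i [mI [hp up] [hi fi] ei pif]]]] := im_ex mY hf.
  have TI : T I := tors_quo tT mX mI hp up TX.
  (* [I], the image of [f], embeds in [E] as the pairs (y, 0), and [L], the kernel of [h], as the
     pairs (0, z). *)
  have [u [hu eu]] : exists u : 'M_(mdim I, mdim E), is_hom u /\ u *m e = row_mx i 0.
    apply: (@hom_factor_sub k Q E (dsum Y Z) I) => //.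
      by apply: hom_row => //; exact: hom0.
    by rewrite ee mul_row_col mul0mx addr0 -ec ei.
  have [l [hl el]] : exists l : 'M_(mdim L, mdim E), is_hom l /\ l *m e = row_mx 0 j.
    apply: (@hom_factor_sub k Q E (dsum Y Z) L) => //.
      by apply: hom_row => //; exact: hom0.
    by rewrite ee mul_row_col mul0mx add0r mulmxN oppr_eq0 -ej.
  have TE : T E.
    apply: (@tors_ext k Q T tT I E Z u pZ) => //.
    + apply: (@row_free_mull _ _ _ _ u e); rewrite eu.
      apply: (@row_free_mull _ _ _ _ _ (col_mx 1%:M 0)).
      by rewrite mul_row_col mulmx1 mul0mx addr0.
    + rewrite -sub1mx.
      have [g gc] : exists g, g *m c = h.
        by exists (h *m pinvmx c); rewrite -mulmxA mulVpmx // mulmx1.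
      have : (row_mx g 1%:M <= e)%MS by rewrite ee mul_row_col mul1mx gc subrr.
      case/submxP=> D hD; apply/submxP; exists D.
      by rewrite /pZ mulmxA -hD mul_row_col mulmx0 mulmx1 add0r.
    + apply: exactI => [|v]; first by rewrite /pZ mulmxA eu mul_row_col mulmx0 mul0mx addr0.
      move=> vp; rewrite -(submxMfree _ _ fe) eu.
      have : v *m e = row_mx (v *m pY) 0 by rewrite {1}eE mul_mx_row vp.
      move=> ve; rewrite ve.
      have : v *m e *m col_mx c (- h) = 0 by rewrite -mulmxA (exact_mul0 ee) mulmx0.
      rewrite ve mul_row_col mul0mx addr0 => /eqP; rewrite -ec -ei => /submxP[D ->].
      by apply/submxP; exists D; rewrite mul_mx_row mulmx0.
  apply: (HY E L pY l) => //.
    apply: (@row_free_mull _ _ _ _ l e); rewrite el.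
    apply: (@row_free_mull _ _ _ _ _ (col_mx 0 1%:M)).
    by rewrite mul_row_col mulmx1 mulmx0 add0r.
  apply: exactI => [|v vp]; first by rewrite /pY mulmxA el mul_row_col mulmx0 mul0mx addr0.
  rewrite -(submxMfree _ _ fe) el.
  have ve : v *m e = row_mx 0 (v *m pZ) by rewrite {1}eE mul_mx_row vp.
  rewrite ve.
  have : v *m e *m col_mx c (- h) = 0 by rewrite -mulmxA (exact_mul0 ee) mulmx0.
  rewrite ve mul_row_col mul0mx add0r mulmxN => /eqP; rewrite oppr_eq0 -ej => /submxP[D ->].
  by apply/submxP; exists D; rewrite mul_mx_row mulmx0.
- move=> L X N f g mL mX mN hf hg [ff ug fg0 r] [TL HL] [TN HN].
  have e := exact_of_rank fg0 r.
  split; first exact: (@tors_ext k Q T tT L X N f g).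
  move=> Z K h i mZ mK hh hi fi ei TZ.
  (* The kernel of [h] is taken in two stages: the kernel [Z'] of [Z -> N] lies in [T] because of
     [N]; then [h] maps [Z'] into [L] with kernel [K]. *)
  have hhg := hom_mul hh hg.
  have [Z' [i' [mZ' hi' fi' ei']]] := ker_ex mZ hhg.
  have TZ' : T Z' by apply: (HN Z Z' (h *m g) i').
  have [h' [hh' eh']] : exists h' : 'M_(mdim Z', mdim L), is_hom h' /\ h' *m f = i' *m h.
    apply: hom_factor_sub => //; first exact: hom_mul.
    by rewrite e -mulmxA -ei'.
  have [m [hm em]] : exists m : 'M_(mdim K, mdim Z'), is_hom m /\ m *m i' = i.
    by apply: hom_factor_sub => //; rewrite ei' mulmxA (exact_mul0 ei) mul0mx.
  apply: (HL Z' K h' m) => //; first by apply: (@row_free_mull _ _ _ _ m i'); rewrite em.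
  move=> a v; rewrite -(submxMfree _ _ fi') em ei -mulmxA -eh' mulmxA.
  by rewrite mulmx_free_eq0.
Qed.

End LeftFinite.

(** * Generated classes, and maps from them into a semibrick *)

Section Generated.
Variables (k : fieldType) (Q : bquiver) (I : Type) (M : I -> rmod k Q) (B : I -> Prop).
Hypothesis M_module : forall p, B p -> is_module (M p).
Implicit Types X Y Z K C L N : rmod k Q.

(** Different indices may give isomorphic modules, as a word and its inverse do. Closure under
    isomorphism within [B] makes the predicate depend on isomorphism classes only, so that two
    semibricks can be proved equal as predicates. *)
Definition semibrick (S : I -> Prop) :=
  [/\ forall p, S p -> B p,
      forall p q, S p -> B q -> iso (M p) (M q) -> S q &
      forall p q (f : 'M_(mdim (M p), mdim (M q))),
        S p -> S q -> is_hom f -> f != 0 -> row_free f && row_full f].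

Definition gen_tors (S : I -> Prop) X :=
  forall T, torsion_class T -> (forall p, S p -> T (M p)) -> T X.

Definition gen_wide (S : I -> Prop) X :=
  forall W, wide_subcat W -> (forall p, S p -> W (M p)) -> W X.

Lemma gen_tors_tors S : torsion_class (gen_tors S).
Proof.
split=> [T tT _|X Y f mX mY hf uf TX T tT ST|L X N f g mL mX mN hf hg e TL TN T tT ST].
- exact: tors0.
- by apply: (tors_quo tT mX mY hf uf); exact: TX.
- by case: (tT) => _ _ H; apply: (H L X N f g) => //; [exact: TL | exact: TN].
Qed.

Lemma gen_tors_mem S p : S p -> gen_tors S (M p).
Proof. by move=> Sp T _; exact. Qed.

Lemma gen_wide_wide S : wide_subcat (gen_wide S).
Proof.
split=> [T tT _|X Y f mX mY hf ff uf TX T tT ST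
  |X Y K f i mX mY mK hf hi fi if0 r TX TY T tT ST
  |X Y C f c mX mY mC hf hc uc fc0 r TX TY T tT ST
  |L X N f g mL mX mN hf hg e TL TN T tT ST]; case: (tT) => H1 H2 H3 H4 H5 //.
- by apply: (H2 X Y f) => //; exact: TX.
- by apply: (H3 X Y K f i) => //; [exact: TX|exact: TY].
- by apply: (H4 X Y C f c) => //; [exact: TX|exact: TY].
- by apply: (H5 L X N f g) => //; [exact: TL | exact: TN].
Qed.

Lemma gen_wide_mem S p : S p -> gen_wide S (M p).
Proof. by move=> Sp T _; exact. Qed.

(** The modules from which every nonzero map to [M p] is onto form a torsion class containing [S].
    For an extension, a map that is nonzero on the submodule is already onto there, and one that
    vanishes on it factors through the quotient. *)
Lemma gen_tors_surj S : semibrick S -> forall Y p (f : 'M_(mdim Y, mdim (M p))),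
  gen_tors S Y -> is_module Y -> S p -> is_hom f -> f != 0 -> row_full f.
Proof.
move=> [SB Siso Sh] Y p f TY mY Sp hf f0.
pose T Y := is_module Y -> forall f : 'M_(mdim Y, mdim (M p)), is_hom f -> f != 0 -> row_full f.
suff: T Y by apply.
apply: TY => [|q Sq _ g hg g0]; last by case/andP: (Sh q p g Sq Sp hg g0).
split=> [|X Z h mX mZ hh uh TX _ g hg g0|L X N i c mL mX mN hi hc [fi uc ic0 r] TL TN _ g hg g0].
- by move=> _ g _ /eqP[]; apply/matrixP => -[].
- apply: (@row_full_mulr _ _ _ _ h); apply: TX => //; first exact: hom_mul.
  by apply: contra g0 => /eqP/(row_full_mull0 uh) ->.
- have e := exact_of_rank ic0 r.
  have [ig0|ig0] := eqVneq (i *m g) 0; last first.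
    by apply: (@row_full_mulr _ _ _ _ i); apply: TL => //; exact: hom_mul.
  have [h [hh ch]] : exists h : 'M_(mdim N, mdim (M p)), is_hom h /\ c *m h = g.
    apply: hom_factor_quo => //; apply: (@submx_trans _ _ _ _ _ _ i).
      by rewrite e mulmx_ker.
    by rewrite sub_kermx ig0.
  rewrite -ch; apply: row_full_mul => //; apply: TN => //.
  by apply: contra g0 => /eqP h0; rewrite -ch h0 mulmx0.
Qed.

(** The property that a nonzero map to [X] yields such a [p] and [g] passes to quotients and
    extensions, hence from [S] to the torsion class it generates. *)
Lemma gen_tors_nonzero S Y X (f : 'M_(mdim Y, mdim X)) :
  gen_tors S Y -> is_module Y -> is_hom f -> f != 0 ->
  exists p (g : 'M_(mdim (M p), mdim X)), [/\ S p, is_hom g & g != 0].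
Proof.
move=> TY mY hf f0.
pose P := exists p (g : 'M_(mdim (M p), mdim X)), [/\ S p, is_hom g & g != 0].
pose T Y := is_module Y -> forall f : 'M_(mdim Y, mdim X), is_hom f -> f != 0 -> P.
suff H : T Y by exact: (H mY f).
apply: TY => [|q Sq _ g hg g0]; last by exists q, g.
split=> [|L Z h mL mZ hh uh TL _ g hg g0|L Z N i c mL mX mN hi hc [fi uc ic0 r] TL TN _ g hg g0].
- by move=> _ g _ /eqP[]; apply/matrixP => -[].
- apply: (TL mL (h *m g)); first exact: hom_mul.
  by apply: contra g0 => /eqP/(row_full_mull0 uh) ->.
- have e := exact_of_rank ic0 r.
  have [ig0|ig0] := eqVneq (i *m g) 0; last by apply: (TL mL (i *m g)) => //; exact: hom_mul.
  have [h [hh ch]] : exists h : 'M_(mdim N, mdim X), is_hom h /\ c *m h = g.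
    apply: hom_factor_quo => //; apply: (@submx_trans _ _ _ _ _ _ i).
      by rewrite e mulmx_ker.
    by rewrite sub_kermx ig0.
  by apply: (TN mN h) => //; apply: contra g0 => /eqP h0; rewrite -ch h0 mulmx0.
Qed.

Lemma one_neq0 X : (0 < mdim X)%N -> (1%:M : 'M[k]_(mdim X)) != 0.
Proof.
case: (mdim X) => // n _; apply/eqP => /matrixP/(_ 0 0); rewrite !mxE eqxx => /eqP.
by rewrite oner_eq0.
Qed.

Hypothesis M_pos : forall p, (0 < mdim (M p))%N.

Lemma gen_tors_sub_inj S S' : semibrick S -> semibrick S' ->
  (forall X, gen_tors S X <-> gen_tors S' X) -> forall p, S p -> S' p.
Proof.
move=> bS bS' E p Sp; have [SB Siso Sh] := bS; have [SB' Siso' Sh'] := bS'.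
have mp := M_module (SB _ Sp).
have [q [g [Sq hg g0]]] : exists q (g : 'M_(mdim (M q), mdim (M p))), [/\ S' q, is_hom g & g != 0].
  apply: (gen_tors_nonzero (f := 1%:M) _ mp (hom1 _) (one_neq0 (M_pos p))).
  by apply/E; exact: gen_tors_mem.
have mq := M_module (SB' _ Sq).
have [r [h [Sr hh h0]]] : exists r (h : 'M_(mdim (M r), mdim (M q))), [/\ S r, is_hom h & h != 0].
  apply: (gen_tors_nonzero (f := 1%:M) _ mq (hom1 _) (one_neq0 (M_pos q))).
  by apply/E; exact: gen_tors_mem.
have mr := M_module (SB _ Sr).
have ug : row_full g by apply: (gen_tors_surj bS _ mq) => //; apply/E; exact: gen_tors_mem.
have uh : row_full h by apply: (gen_tors_surj bS' _ mr) => //; apply/E; exact: gen_tors_mem.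
have gh0 : h *m g != 0 by apply: contra g0 => /eqP/(row_full_mull0 uh) ->.
have /andP[fhg _] := Sh r p (h *m g) Sr Sp (hom_mul hh hg) gh0.
(* [h] is onto, and injective as the first factor of an injective composite; cancelling it leaves
   [g] injective. *)
have fg : row_free g.
  have /row_freeP[t ht] := fhg.
  have [h' [_ _ hh']] := hom_inv hh (row_free_mull fhg) uh.
  have := uh => /row_fullP[h'' e]; apply/row_freeP; exists (t *m h).
  by rewrite -[LHS]mul1mx -e !mulmxA -(mulmxA h'') -(mulmxA h'') ht mulmx1 e.
by apply: (Siso' q p) => //; [exact: SB | exists g].
Qed.

(** The kernel condition, joined with membership in the generated torsion class, is itself a torsion
    class. It contains [S], since a map between members is zero or injective. *)
Lemma semibrick_wideL S : semibrick S -> forall p, S p -> wideL (gen_tors S) (M p).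
Proof.
move=> bS p Sp; have [SB Siso Sh] := bS; split; first exact: gen_tors_mem.
have tT := gen_tors_tors S.
move=> Z K h i mZ mK hh hi fi e TZ.
pose T Z := gen_tors S Z /\ (is_module Z ->
  forall K (h : 'M[k]_(mdim Z, mdim (M p))) (i : 'M[k]_(mdim K, mdim Z)),
    is_module K -> is_hom h -> is_hom i -> row_free i -> exact i h -> gen_tors S K).
suff [_ H] : T Z by exact: (H mZ K h i).
have triv Y L (g : 'M_(mdim Y, mdim (M p))) (j : 'M_(mdim L, mdim Y)) : gen_tors S Y ->
    is_module Y -> is_module L -> is_hom j -> row_free j -> exact j g -> g = 0 -> gen_tors S L.
  move=> TY mY mL hj fj ej g0.
  have uj : row_full j by rewrite -sub1mx ej g0 mulmx0.
  have [g' [hg' gi ig]] := hom_inv hj fj uj.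
  by apply: (tors_quo tT mY mL hg' _ TY); apply/row_fullP; exists j.
apply: TZ => {Z K h i mZ mK hh hi fi e} [|q Sq]; last first.
  split; first exact: gen_tors_mem.
  move=> mq K h i mK hh hi fi e; have [h0|h0] := eqVneq h 0.
    exact: (triv (M q) K h i (gen_tors_mem Sq)).
  have /andP[fh _] := Sh q p h Sq Sp hh h0.
  have i0 : i = 0 by apply: (row_free_mulr0 fh); exact: exact_mul0.
  have := fi; rewrite /row_free i0 mxrank0 => /eqP K0.
  apply: (tors_quo tT (@zero_module k Q) mK (@hom0 k Q _ _) _ (tors0 tT)).
  by rewrite /row_full mxrank0 -K0.
split.
- split; first exact: tors0.
  move=> m0 K h i mK hh hi fi e; apply: (triv (zero_mod k Q) K h i) => //.
    exact: tors0.
  by apply/matrixP => -[].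
(* The kernel [L] of the composite [X -> Y -> M p] maps onto the kernel [K] of [h]. *)
- move=> X Y f mX mY hf uf [TX HX]; have TY := tors_quo tT mX mY hf uf TX.
  split=> // _ K h i mK hh hi fi e.
  have hfh := hom_mul hf hh.
  have [L [j [mL hj fj ej]]] := ker_ex mX hfh.
  have TL := HX mX L _ j mL hfh hj fj ej.
  have [c [hc ce]] : exists c : 'M_(mdim L, mdim K), is_hom c /\ c *m i = j *m f.
    by apply: hom_factor_sub => //; [exact: hom_mul|rewrite e -mulmxA (exact_mul0 ej)].
  apply: (tors_quo tT mL mK hc _ TL).
  rewrite -sub1mx -(submxMfree _ _ fi) ce mul1mx.
  have /row_fullP[f' f'f] := uf.
  have : (i *m f' <= j)%MS by rewrite ej -!mulmxA (mulmxA f') f'f mul1mx (exact_mul0 e).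
  by move=> /(submxMr f); rewrite -mulmxA f'f mulmx1.
- move=> L X N f g mL mX mN hf hg [ff ug fg0 r] [TL HL] [TN HN].
  have e := exact_of_rank fg0 r.
  have TX : gen_tors S X by exact: (@tors_ext k Q _ tT L X N f g).
  split=> // _ K h i mK hh hi fi ei.
  (* If [h] vanishes on [L], it factors through [N], and [K] is an extension of the kernel of
     [N -> M p] by [L]. *)
  have [fh0|fh0] := eqVneq (f *m h) 0.
    have [h' [hh' gh']] : exists h' : 'M_(mdim N, mdim (M p)), is_hom h' /\ g *m h' = h.
      apply: hom_factor_quo => //; apply: (@submx_trans _ _ _ _ _ _ f).
        by rewrite e mulmx_ker.
      by rewrite sub_kermx fh0.
    have [K' [i' [mK' hi' fi' ei']]] := ker_ex mN hh'.
    have TK' := HN mN K' h' i' mK' hh' hi' fi' ei'.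
    have [c [hc ce]] : exists c : 'M_(mdim K, mdim K'), is_hom c /\ c *m i' = i *m g.
      apply: hom_factor_sub => //; first exact: hom_mul.
      by rewrite ei' -mulmxA gh' (exact_mul0 ei).
    have [u [hu ue]] : exists u : 'M_(mdim L, mdim K), is_hom u /\ u *m i = f.
      by apply: hom_factor_sub => //; rewrite ei fh0.
    apply: (@tors_ext k Q _ tT L K K' u c) => //.
    + by apply: (@row_free_mull _ _ _ _ u i); rewrite ue.
    + rewrite -sub1mx -(submxMfree _ _ fi') ce mul1mx.
      have /row_fullP[g' g'g] := ug.
      have : (i' *m g' <= i)%MS by rewrite ei -mulmxA -gh' (mulmxA g') g'g mul1mx (exact_mul0 ei').
      by move=> /(submxMr g); rewrite -mulmxA g'g mulmx1.
    + move=> a v; rewrite -(submxMfree _ _ fi) ue e -mulmxA -ce mulmxA.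
      by rewrite mulmx_free_eq0.
  (* Otherwise [L] already maps onto [M p], so [K] still maps onto [N], and the kernel of [K -> N]
     is the kernel of [L -> M p]. *)
  have hfh := hom_mul hf hh.
  have ufh : row_full (f *m h) := gen_tors_surj bS TL mL Sp hfh fh0.
  have [K' [i' [mK' hi' fi' ei']]] := ker_ex mL hfh.
  have TK' := HL mL K' _ i' mK' hfh hi' fi' ei'.
  have [u [hu ue]] : exists u : 'M_(mdim K', mdim K), is_hom u /\ u *m i = i' *m f.
    by apply: hom_factor_sub => //; [exact: hom_mul|rewrite ei -mulmxA (exact_mul0 ei')].
  apply: (@tors_ext k Q _ tT K' K N u (i *m g)) => //.
  + exact: hom_mul.
  + by apply: (@row_free_mull _ _ _ _ u i); rewrite ue; exact: row_free_mul.
  + have /row_fullP[w wfh] := ufh; have /row_fullP[g' g'g] := ug.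
    rewrite -sub1mx.
    (* Lift from [N] to [X] by [g'], then subtract an element of [L] with the same image under [h];
       the difference lies in [K]. *)
    have : (g' - g' *m h *m w *m f <= i)%MS.
      by rewrite ei mulmxBl -!mulmxA wfh mulmx1 subrr.
    by move=> /(submxMr g); rewrite mulmxBl g'g -!mulmxA fg0 !mulmx0 subr0.
  + apply: exactI => [|v].
      by rewrite mulmxA ue -mulmxA fg0 mulmx0.
    rewrite mulmxA => /eqP; rewrite -e => /submxP[D eD].
    rewrite -(submxMfree _ _ fi) ue eD.
    have : (D <= i')%MS by rewrite ei' mulmxA -eD -mulmxA (exact_mul0 ei) mulmx0.
    by move=> /(submxMr f).
Qed.

Lemma gen_wide_sub_tors S : semibrick S -> forall X, gen_wide S X -> gen_tors S X.
Proof.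
move=> bS X /(_ (wideL (gen_tors S))) H.
have [] // : wideL (gen_tors S) X.
by apply: H; [apply: wideL_wide; exact: gen_tors_tors | exact: semibrick_wideL].
Qed.

End Generated.

(** * Shadows inside an additive closure *)

Lemma inj_surj_bijective (A B : Type) (f : A -> B) :
  injective f -> (forall y, exists x, f x = y) -> bijective f.
Proof.
move=> fI fS; pose g y := proj1_sig (constructive_indefinite_description _ (fS y)).
have fg y : f (g y) = y by rewrite /g; case: (constructive_indefinite_description _ _).
by exists g => // x; apply: fI.
Qed.

Lemma pred_ext (A : Type) (P P' : A -> Prop) : (forall x, P x <-> P' x) -> P = P'.
Proof.
by move=> E; apply: functional_extensionality => x; apply: propositional_extensionality.
Qed.

Lemma sig_eq (A : Type) (P : A -> Prop) (u v : {x | P x}) : proj1_sig u = proj1_sig v -> u = v.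
Proof.
by case: u v => [x px] [y py] /= e; subst y; rewrite (proof_irrelevance _ px py).
Qed.

(** One parametrization is inverted and followed by the other. *)
Lemma bijection_through (A B C : Type) (S : A -> Prop) (P : B -> Prop) (P' : C -> Prop)
    (t : A -> B) (w : A -> C) :
  (forall a, S a -> P (t a)) -> (forall a, S a -> P' (w a)) ->
  (forall a b, S a -> S b -> t a = t b -> a = b) ->
  (forall a b, S a -> S b -> w a = w b -> a = b) ->
  (forall y, P y -> exists2 a, S a & t a = y) ->
  (forall y, P' y -> exists2 a, S a & w a = y) ->
  exists f : {y | P y} -> {y | P' y}, bijective f.
Proof.
move=> Pt Pw tI wI tS wS.
pose ft (u : {a | S a}) : {y | P y} := exist _ _ (Pt _ (proj2_sig u)).
pose fw (u : {a | S a}) : {y | P' y} := exist _ _ (Pw _ (proj2_sig u)).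
have bt : bijective ft.
  apply: inj_surj_bijective => [u v [e]|[y Py]].
    by apply: sig_eq; apply: tI e; exact: proj2_sig.
  by have [a Sa e] := tS y Py; exists (exist _ a Sa); apply: sig_eq.
have bw : bijective fw.
  apply: inj_surj_bijective => [u v [e]|[y Py]].
    by apply: sig_eq; apply: wI e; exact: proj2_sig.
  by have [a Sa e] := wS y Py; exists (exist _ a Sa); apply: sig_eq.
have [g ftK gK] := bt; exists (fw \o g).
by apply: bij_comp => //; exists ft.
Qed.

Section Add.
Variables (k : fieldType) (Q : bquiver) (I : eqType) (M : I -> rmod k Q) (B : I -> Prop).
Hypothesis M_module : forall p, B p -> is_module (M p).
Implicit Types X Y Z K C L N : rmod k Q.

(** The additive closure, abstracted from strings. For the modules [smod] indexed by [spec_string]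
    it unfolds to [inM]. *)
Definition in_add X := is_module X /\ exists s : seq I,
  (forall p, p \in s -> B p) /\ iso X (bigsum [seq M p | p <- s]).

Lemma bigsum_module s : (forall p, p \in s -> B p) -> is_module (bigsum [seq M p | p <- s]).
Proof.
elim: s => [|p s IH] H /=; first exact: zero_module.
apply: dsum_module; first by apply: M_module; apply: H; rewrite mem_head.
by apply: IH => q qs; apply: H; rewrite in_cons qs orbT.
Qed.

Lemma dsum0_iso X : iso X (dsum X (zero_mod k Q)).
Proof.
exists (row_mx 1%:M 0); split; [exact: hom_inl | exact: row_mx10_free |].
apply/row_fullP; exists (col_mx 1%:M 0); rewrite mul_col_row mulmx1 mulmx0 mul0mx.
rewrite [RHS]scalar_mx_block; congr (block_mx _ _ _ _); rewrite ?mulmx0 //.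
by apply/matrixP => -[].
Qed.

Lemma in_add_mem p : B p -> in_add (M p).
Proof.
move=> Bp; split; first exact: M_module.
by exists [:: p]; split=> [q|/=]; [rewrite inE => /eqP -> | exact: dsum0_iso].
Qed.

Definition summand_closed (T : rmod k Q -> Prop) :=
  forall X Y, is_module X -> is_module Y -> T (dsum X Y) -> T X /\ T Y.

(** The summands of a module in [T] stay in [T], and [C] rebuilds the sum by extensions. The
    dimension bound is kept because it drives the inductions that reduce to smaller modules. *)
Lemma in_add_ind (T C : rmod k Q -> Prop) X :
  summand_closed T -> iso_closed T ->
  ext_closed C -> iso_closed C -> C (zero_mod k Q) ->
  in_add X -> T X ->
  (forall p, B p -> T (M p) -> (mdim (M p) <= mdim X)%N -> C (M p)) -> C X.
Proof.
move=> sT iT eC iC C0 [mX [s [sB Xs]]] TX H.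
have ms := bigsum_module sB.
apply: (iC _ _ ms mX (iso_sym Xs)).
have {TX}: T (bigsum [seq M p | p <- s]) by exact: iT TX.
have {Xs}: (mdim (bigsum [seq M p | p <- s]) <= mdim X)%N by rewrite (iso_dim Xs).
elim: s sB ms => [|p s IH] //= sB ms ds Ts.
have Bp : B p by apply: sB; rewrite mem_head.
have mp := M_module Bp.
have sB' q : q \in s -> B q by move=> qs; apply: sB; rewrite in_cons qs orbT.
have ms' := bigsum_module sB'.
have [Tp Ts'] := sT _ _ mp ms' Ts.
apply: ext_dsum => //.
  by apply: H => //; apply: leq_trans ds; exact: leq_addr.
by apply: IH => //; apply: leq_trans ds; exact: leq_addl.
Qed.

Hypothesis M_pos : forall p, (0 < mdim (M p))%N.
Variable bound : nat.
Hypothesis M_bound : forall p, B p -> (mdim (M p) <= bound)%N.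
Hypothesis ker_in_add : forall p q (f : 'M_(mdim (M p), mdim (M q))) K (i : 'M_(mdim K, _)),
  B p -> B q -> is_hom f -> is_module K -> is_hom i -> row_free i -> exact i f -> in_add K.
Hypothesis im_in_add : forall p q (f : 'M_(mdim (M p), mdim (M q))) J (j : 'M_(mdim J, _)),
  B p -> B q -> is_hom f -> is_module J -> is_hom j -> row_free j -> (j :=: f)%MS -> in_add J.
Hypothesis coker_in_add : forall p q (f : 'M_(mdim (M p), mdim (M q))) C (c : 'M_(_, mdim C)),
  B p -> B q -> is_hom f -> is_module C -> is_hom c -> row_full c -> exact f c -> in_add C.

Notation semib := (semibrick M B).

Lemma tors_semibrick T : torsion_class T ->
  exists2 S, semib S & forall X, (T X /\ in_add X) <-> (gen_tors M S X /\ in_add X).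
Proof.
move=> tT.
(* The modules of [S1] generate by descending induction on the dimension (replace a
   map that is not onto by its image and cokernel), those of [S] by ascending
   induction (a surjection that is not an isomorphism has a larger source). *)
pose S1 q := [/\ B q, T (M q) & forall p (f : 'M_(mdim (M p), mdim (M q))),
  B p -> T (M p) -> is_hom f -> f != 0 -> row_full f].
pose S q := S1 q /\ forall p (f : 'M_(mdim (M p), mdim (M q))),
  S1 p -> is_hom f -> f != 0 -> row_free f.
(* A nonzero map between members is onto by [S1] and injective by the second condition; both
   conditions are transported along isomorphisms. *)
have bS : semib S.
  split=> [p [[]] //|p q [[Bp Tp Hp] Hp'] Bq [u [hu fu uu]]|p q f [Sp _] [[Bq Tq Hq] Hq'] hf f0].
    have nz n (f : 'M_(n, mdim (M p))) : f *m u != 0 -> f != 0.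
      by apply: contra => /eqP ->; rewrite mul0mx.
    have [v [hv vu uv]] := hom_inv hu fu uu.
    have fv : row_free v by apply/row_freeP; exists u.
    have uv' : row_full v by apply/row_fullP; exists u.
    split; first split=> //; first exact: (tors_quo tT (M_module Bp) (M_module Bq) hu).
      move=> r f Br Tr hf f0; apply: (@row_full_mulr _ _ _ _ 1%:M).
      rewrite mul1mx -[f]mulmx1 -vu mulmxA; apply: row_full_mul => //.
      apply: (Hp r) => //; first exact: hom_mul.
      by apply: nz; rewrite -mulmxA vu mulmx1.
    move=> r f Sr hf f0; apply: (@row_free_mull _ _ _ _ f v); apply: (Hp' r) => //.
      exact: hom_mul.
    by apply: nz; rewrite -mulmxA vu mulmx1.
  have [Bp Tp _] := Sp.
  by apply/andP; split; [apply: (Hq' p) | apply: (Hq p)].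
exists S => // X.
have tS := gen_tors_tors M S.
(* A member of [S1] outside [S] is a quotient of a strictly larger member of [S1]. Dimensions are at
   most [bound], so the recursion runs on the distance to it. *)
have S1T p : S1 p -> gen_tors M S (M p).
  move: {2}(bound - mdim (M p))%N (leqnn (bound - mdim (M p))) => n.
  elim: n p => [|n IH] p dn S1p; have [Bp Tp Hp] := S1p.
  (* [M p] has the maximal dimension [bound], so a surjection onto it has no room for a kernel. *)
  - apply: gen_tors_mem; split=> // q f [Bq Tq Hq] hf f0.
    have uf := Hp q f Bq Tq hf f0.
    have : (mdim (M q) <= mdim (M p))%N.
      by apply: leq_trans (M_bound Bq) _; rewrite -subn_eq0 -leqn0.
    move/eqP: uf => uf le; rewrite /row_free eqn_leq rank_leq_row -[X in (_ <= X)%N]uf in le *.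
    exact: le.
  - have [Sp|nSp] := classic (S p); first exact: gen_tors_mem.
    have [q [f [Sq hf f0 ff]]] : exists q (f : 'M_(mdim (M q), mdim (M p))),
        [/\ S1 q, is_hom f, f != 0 & ~~ row_free f].
      apply: NNPP => nex; apply: nSp; split=> // q f Sq hf f0.
      by apply/idPn => nf; apply: nex; exists q, f.
    have [Bq Tq Hq] := Sq; have uf := Hp q f Bq Tq hf f0.
    apply: (tors_quo tS (M_module Bq) (M_module Bp) hf uf); apply: IH => //.
    have lt : (mdim (M p) < mdim (M q))%N.
      move/eqP: uf => uf; rewrite -[X in (X < _)%N]uf.
      by rewrite ltn_neqAle rank_leq_row andbT.
    rewrite -ltnS; apply: leq_trans dn.
    by rewrite ltn_sub2l //; apply: leq_trans lt _; exact: M_bound.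
(* Outside [S1] some nonzero map to [M p] is not onto. Its image and cokernel are smaller, lie in
   [T] as quotients, and have [M p] as an extension. *)
have BT p : B p -> T (M p) -> gen_tors M S (M p).
  move: {2}(mdim (M p)) (leqnn (mdim (M p))) => n.
  elim: n p => [|n IH] p dn Bp Tp; first by have := M_pos p; rewrite ltnNge dn.
  have [Sp|nSp] := classic (S1 p); first exact: S1T.
  have [q [f [Bq Tq hf f0 uf]]] : exists q (f : 'M_(mdim (M q), mdim (M p))),
      [/\ B q, T (M q), is_hom f, f != 0 & ~~ row_full f].
    apply: NNPP => nex; apply: nSp; split=> // q f Bq Tq hf f0.
    by apply/idPn => nf; apply: nex; exists q, f.
  have mp := M_module Bp; have mq := M_module Bq.
  have [J [g [j [mJ [hg ug] [hj fj] ej gjf]]]] := im_ex mp hf.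
  have [C [c [mC hc uc ec]]] := coker_ex mp hf.
  have TJ : T J := tors_quo tT mq mJ hg ug Tq.
  have TC : T C := tors_quo tT mp mC hc uc Tp.
  have aJ : in_add J := im_in_add Bq Bp hf mJ hj fj ej.
  have aC : in_add C := coker_in_add Bq Bp hf mC hc uc ec.
  have r : (\rank f < mdim (M p))%N by rewrite ltn_neqAle rank_leq_col andbT.
  have dJ : (mdim J < mdim (M p))%N.
    by move/eqP: fj => fj; rewrite -[X in (X < _)%N]fj ej.
  have dC : (mdim C < mdim (M p))%N.
    move/eqP: uc => uc; rewrite -[X in (X < _)%N]uc -[X in (_ < X)%N](exact_rank ec).
    by rewrite -[X in (X < _)%N]add0n ltn_add2r lt0n mxrank_eq0.
  have rec Y : in_add Y -> T Y -> (mdim Y < mdim (M p))%N -> gen_tors M S Y.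
    move=> aY TY dY.
    apply: (in_add_ind (T := T) (C := gen_tors M S) _ (tors_iso tT) (tors_ext tS) (tors_iso tS)
             (tors0 tS) aY TY).
      by move=> ? ?; exact: (tors_summand tT).
    move=> r' Br Tr dr; apply: IH => //.
    by rewrite -ltnS; apply: leq_trans dn; apply: leq_ltn_trans dY.
  apply: (tors_ext tS mJ mp mC hj hc fj uc _ (rec J aJ TJ dJ) (rec C aC TC dC)).
  by move=> m v; rewrite ej ec.
split=> -[TX aX]; split=> //; last by apply: TX => // p [[]].
apply: (in_add_ind (T := T) (C := gen_tors M S) _ (tors_iso tT) (tors_ext tS) (tors_iso tS)
         (tors0 tS) aX TX); first by move=> ? ?; exact: (tors_summand tT).
by move=> p Bp Tp _; exact: BT.
Qed.

(** [S] collects the string modules that are simple relative to [W] and the additive closure.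
    Schur's lemma applies because kernels, images and cokernels of maps between string modules stay
    in both. *)
Lemma wide_semibrick W : wide_subcat W ->
  exists2 S, semib S & forall X, (W X /\ in_add X) <-> (gen_wide M S X /\ in_add X).
Proof.
move=> wW.
pose S p := [/\ B p, W (M p) & forall L N (f : 'M_(mdim L, mdim (M p))) (g : 'M_(_, mdim N)),
  is_module L -> is_module N -> is_hom f -> is_hom g -> row_free f -> row_full g ->
  exact f g -> W L -> in_add L -> W N -> in_add N -> (mdim L == 0) || (mdim N == 0)].
have bS : semib S.
  split=> [p [] //|p q [Bp Wp Hp] Bq [u [hu fu uu]]|p q f [Bp Wp Hp] [Bq Wq Hq] hf f0].
    have mp := M_module Bp; have mq := M_module Bq.
    split=> //; first by apply: (wide_iso wW mp mq _ Wp); exists u.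
    have [v [hv vu uv]] := hom_inv hu fu uu.
    have fv : row_free v by apply/row_freeP; exists u.
    move=> L N f g mL mN hf hg ff ug e; apply: (Hp L N (f *m v) (u *m g)) => //.
    - exact: hom_mul.
    - exact: hom_mul.
    - exact: row_free_mul.
    - exact: row_full_mul.
    - move=> m w; rewrite -(submxMfree _ _ fu) -mulmxA vu mulmx1 e.
      by rewrite mulmxA.
  have mp := M_module Bp; have mq := M_module Bq.
  have [K [i [mK hi fi ei]]] := ker_ex mp hf.
  have [J [g [j [mJ [hg ug] [hj fj] ej gjf]]]] := im_ex mq hf.
  have [C [c [mC hc uc ec]]] := coker_ex mq hf.
  have WK := wide_ker wW mp mq mK hf hi fi ei Wp Wq.
  have WC := wide_coker wW mp mq mC hf hc uc ec Wp Wq.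
  have WJ := wide_im wW mp mq mJ hg hj ug fj Wp Wq.
  have aK := ker_in_add Bp Bq hf mK hi fi ei.
  have aJ := im_in_add Bp Bq hf mJ hj fj ej.
  have aC := coker_in_add Bp Bq hf mC hc uc ec.
  have eig : exact i g by apply/(exact_mulfree _ _ fj); rewrite gjf.
  have ejc : exact j c by move=> m v; rewrite ej ec.
  have J0 : (mdim J == 0) = false.
    apply/negP => /eqP J0; case/eqP: f0; apply/eqP; rewrite -mxrank_eq0 -ej.
    by have := rank_leq_row j; rewrite [X in (_ <= X)%N]J0 leqn0.
  (* [M p] is an extension of the nonzero image [J] by the kernel [K], so [K] is zero; the cokernel
     vanishes likewise. *)
  have := Hp K J i g mK mJ hi hg fi ug eig WK aK WJ aJ; rewrite J0 orbF => /eqP K0.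
  have := Hq J C j c mJ mC hj hc fj uc ejc WJ aJ WC aC; rewrite J0 /= => /eqP C0.
  apply/andP; split.
    rewrite -kermx_eq0 -mxrank_eq0 -leqn0.
    have : (kermx f <= i)%MS by rewrite ei mulmx_ker.
    by move=> /mxrankS /leq_trans; apply; have := rank_leq_row i; rewrite [X in (_ <= X)%N]K0.
  rewrite /row_full -[X in _ == X](exact_rank ec).
  have /eqP -> : \rank c == 0%N by have := rank_leq_col c; rewrite [X in (_ <= X)%N]C0 leqn0.
  by rewrite addn0.
exists S => // X.
have wS := gen_wide_wide M S.
have BT p : B p -> W (M p) -> gen_wide M S (M p).
  move: {2}(mdim (M p)) (leqnn (mdim (M p))) => n.
  elim: n p => [|n IH] p dn Bp Wp; first by have := M_pos p; rewrite ltnNge dn.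
  have [Sp|nSp] := classic (S p); first exact: gen_wide_mem.
  have mp := M_module Bp.
  (* A failure of relative simplicity exhibits [M p] as an extension of two smaller modules, to
     which the induction applies summand by summand. *)
  apply: NNPP => nG; apply: nSp; split=> // L N f g mL mN hf hg ff ug e WL aL WN aN.
  apply/negPn/negP; rewrite negb_or => /andP[L0 N0]; apply: nG.
  have r : (mdim L + mdim N)%N = mdim (M p).
    move/eqP: ff => ff; move/eqP: ug => ug.
    by rewrite -[X in (X + _)%N]ff -[X in (_ + X)%N]ug (exact_rank e).
  have rec Y : in_add Y -> W Y -> (mdim Y < mdim (M p))%N -> gen_wide M S Y.
    move=> aY TY dY.
    apply: (in_add_ind (T := W) (C := gen_wide M S) _ (wide_iso wW) (wide_ext wS) (wide_iso wS)
             (wide0 wS) aY TY).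
      by move=> ? ?; exact: (wide_summand wW).
    move=> r' Br Tr dr; apply: IH => //.
    by rewrite -ltnS; apply: leq_trans dn; apply: leq_ltn_trans dY.
  apply: (wide_ext wS mL mp mN hf hg ff ug e); apply: rec => //; rewrite -r.
    by rewrite -[X in (X < _)%N]addn0 ltn_add2l lt0n.
  by rewrite -[X in (X < _)%N]add0n ltn_add2r lt0n.
split=> -[TX aX]; split=> //; last by apply: TX => // p [].
apply: (in_add_ind (T := W) (C := gen_wide M S) _ (wide_iso wW) (wide_ext wS) (wide_iso wS)
         (wide0 wS) aX TX); first by move=> ? ?; exact: (wide_summand wW).
by move=> p Bp Tp _; exact: BT.
Qed.

(** Only the generators are compared. Equal torsion shadows give this directly, and equal wide
    shadows give it through [gen_wide_sub_tors]. *)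
Lemma gen_tors_inj S S' : semib S -> semib S' ->
  (forall p, S p -> gen_tors M S' (M p)) -> (forall p, S' p -> gen_tors M S (M p)) -> S = S'.
Proof.
move=> bS bS' H H'.
have E X : gen_tors M S X <-> gen_tors M S' X.
  by split=> TX; apply: TX => //; exact: gen_tors_tors.
apply: pred_ext => p; split; apply: (gen_tors_sub_inj M_module) => // X; exact: iff_sym.
Qed.

Lemma shadows_bijection :
  exists f : {P | exists T, torsion_class T /\ P = (fun X => T X /\ in_add X)} ->
             {P | exists W, wide_subcat W /\ P = (fun X => W X /\ in_add X)}, bijective f.
Proof.
apply: (@bijection_through _ _ _ semib _ _
  (fun S X => gen_tors M S X /\ in_add X) (fun S X => gen_wide M S X /\ in_add X)).
- by move=> S _; exists (gen_tors M S); split=> //; exact: gen_tors_tors.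
- by move=> S _; exists (gen_wide M S); split=> //; exact: gen_wide_wide.
- move=> S S' bS bS' e; have [SB _ _] := bS; have [SB' _ _] := bS'.
  have E X : (gen_tors M S X /\ in_add X) = (gen_tors M S' X /\ in_add X) by rewrite (f_equal (@^~ X) e).
  apply: gen_tors_inj => // p Sp.
    have [] // : gen_tors M S' (M p) /\ in_add (M p).
    by rewrite -E; split; [exact: gen_tors_mem|exact/in_add_mem/SB].
  have [] // : gen_tors M S (M p) /\ in_add (M p).
  by rewrite E; split; [exact: gen_tors_mem|exact/in_add_mem/SB'].
- move=> S S' bS bS' e; have [SB _ _] := bS; have [SB' _ _] := bS'.
  have E X : (gen_wide M S X /\ in_add X) = (gen_wide M S' X /\ in_add X) by rewrite (f_equal (@^~ X) e).
  apply: gen_tors_inj => // p Sp.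
    apply: (gen_wide_sub_tors bS'); have [] // : gen_wide M S' (M p) /\ in_add (M p).
    by rewrite -E; split; [exact: gen_wide_mem|exact/in_add_mem/SB].
  apply: (gen_wide_sub_tors bS); have [] // : gen_wide M S (M p) /\ in_add (M p).
  by rewrite E; split; [exact: gen_wide_mem|exact/in_add_mem/SB'].
- move=> P [T [tT ->]]; have [S bS E] := tors_semibrick tT.
  by exists S => //; apply: pred_ext => X; apply: iff_sym.
- move=> P [W [wW ->]]; have [S bS E] := wide_semibrick wW.
  by exists S => //; apply: pred_ext => X; apply: iff_sym.
Qed.

End Add.

(** * String modules *)

Lemma onth_take (T : Type) n (s : seq T) i :
  onth (take n s) i = if (i < n)%N then onth s i else None.
Proof.
rewrite !onthE map_take; case: ltnP => h; first by rewrite nth_take.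
by rewrite nth_default // size_take_min geq_min h.
Qed.

Lemma onth_drop (T : Type) n (s : seq T) i : onth (drop n s) i = onth s (n + i).
Proof. by rewrite !onthE map_drop nth_drop. Qed.

Lemma onth_lt (T : Type) (s : seq T) i x : onth s i = Some x -> (i < size s)%N.
Proof. by move=> e; rewrite -onthTE e. Qed.

Lemma onth_ex (T : Type) (s : seq T) i : (i < size s)%N -> exists x, onth s i = Some x.
Proof. by rewrite -onthTE; case: (onth s i) => // x _; exists x. Qed.

Section Strings.
Variable Q : bquiver.
Implicit Types (x v : vtx Q) (w : seq (letter Q)) (l : letter Q) (a b : arr Q).

Lemma string_start x w l : is_string x w -> onth w 0 = Some l -> lsrc l = x.
Proof. by case: w => [|l' w] // [H _] [<-]; exact: H. Qed.

Lemma string_next x w i l1 l2 : is_string x w ->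
  onth w i = Some l1 -> onth w i.+1 = Some l2 -> string_step l1 l2.
Proof.
move=> [_ H] e1 e2; apply: (H (take i w) (drop i.+2 w)).
have lt := onth_lt e2.
rewrite -[LHS](cat_take_drop i) (drop_nth l1) ?(ltnW lt) //; congr (_ ++ _ :: _).
  by rewrite (onth_nth _ _ _ _ e1).
by rewrite (drop_nth l2) // (onth_nth _ _ _ _ e2).
Qed.

Lemma stringI x w :
  (forall l, onth w 0 = Some l -> lsrc l = x) ->
  (forall i l1 l2, onth w i = Some l1 -> onth w i.+1 = Some l2 -> string_step l1 l2) ->
  is_string x w.
Proof.
move=> H1 H2; split=> [l w' e|w1 w2 l1 l2 e]; first by apply: H1; rewrite e.
by apply: (H2 (size w1)); rewrite e onth_cat ?ltnn ?subnn // ltnNge leqnSn /= subSnn.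
Qed.

Lemma svert_tgt x w i l : onth w i = Some l -> svert x w i.+1 = ltgt l.
Proof.
move=> e; rewrite /svert /= (nth_map l) ?(onth_lt e) //.
by rewrite (onth_nth _ _ _ _ e).
Qed.

Lemma svert_src x w i l : is_string x w -> onth w i = Some l -> svert x w i = lsrc l.
Proof.
move=> s; case: i => [|i] e; first by rewrite (string_start s e).
have [l' e'] := onth_ex (ltnW (onth_lt e)).
by rewrite (svert_tgt x e'); have [] := string_next s e' e.
Qed.

Lemma svert_sub x w p n j : (p <= size w)%N -> (j <= n)%N -> (p + j <= size w)%N ->
  svert (svert x w p) (take n (drop p w)) j = svert x w (p + j).
Proof.
move=> pw jn le; case: j jn le => [|j] jn le; first by rewrite addn0.
have [l e] : exists l, onth w (p + j) = Some l by apply: onth_ex; rewrite -addnS.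
rewrite addnS (svert_tgt x e); apply: svert_tgt.
by rewrite onth_take jn onth_drop.
Qed.

Lemma substring x w p n : is_string x w -> (p <= size w)%N ->
  is_string (svert x w p) (take n (drop p w)).
Proof.
move=> s pw; apply: stringI => [l|i l1 l2]; rewrite !onth_take !onth_drop.
  by case: ifP => // _; rewrite addn0 => /(svert_src s).
case: ifP => // _ e1; case: ifP => // _; rewrite addnS.
exact: (string_next s e1).
Qed.

(** For [s] true: the arrow [a] sends the basis vector at position [p] to the one at [q]. For [s]
    false: the converse relation, that is the transposed matrix. *)
Definition walk (s : bool) w a (p q : nat) : bool :=
  (q == p.+1) && (onth w p == Some (a, s)) || (p == q.+1) && (onth w q == Some (a, ~~ s)).

Lemma walkN s w a p q : walk (~~ s) w a p q = walk s w a q p.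
Proof. by rewrite /walk negbK orbC. Qed.

(** Two different targets would be the two neighbours of [p], reached through a letter and its
    inverse side by side. *)
Lemma walk_fun x s w a p q q' : is_string x w ->
  walk s w a p q -> walk s w a p q' -> q = q'.
Proof.
move=> st /orP[] /andP[/eqP -> /eqP e] /orP[] /andP[/eqP h /eqP e'].
- by rewrite h.
- subst p; have [_ H _ _] := string_next st e' e.
  by case: H; split=> //=; case: s {e e'}.
- have [_ H _ _] := string_next st e e'.
  by case: H; split=> //=; case: s {e e'}.
- by case: h.
Qed.

Lemma walk_inj x s w a p p' q : is_string x w ->
  walk s w a p q -> walk s w a p' q -> p = p'.
Proof. by move=> st; rewrite -!(walkN s); exact: (walk_fun st). Qed.

Lemma walk_src x w a p q : is_string x w -> walk true w a p q -> svert x w p = src a.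
Proof.
move=> st /orP[] /andP[/eqP h /eqP e]; first by rewrite (svert_src st e).
by rewrite h (svert_tgt x e).
Qed.

Lemma walk_tgt x w a p q : is_string x w -> walk true w a p q -> svert x w q = tgt a.
Proof.
move=> st /orP[] /andP[/eqP h /eqP e]; first by rewrite h (svert_tgt x e).
by rewrite (svert_src st e).
Qed.

End Strings.

Lemma sum_only (V : zmodType) (I : finType) (F : I -> V) i :
  (forall j, j != i -> F j = 0) -> \sum_j F j = F i.
Proof. by move=> H; rewrite (bigD1 i) //= big1 ?addr0. Qed.

(** * Actions on string modules and the module axioms *)

Section StringModules.
Variables (k : fieldType) (Q : bquiver).
Implicit Types (x v : vtx Q) (w : seq (letter Q)) (l : letter Q) (a b : arr Q).

Local Arguments smod : simpl never.

Definition wmx s w a : 'M[k]_((size w).+1) := \matrix_(p, q) (walk s w a p q)%:R.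

Lemma tr_wmx s w a : (wmx s w a)^T = wmx (~~ s) w a.
Proof. by apply/matrixP => p q; rewrite !mxE walkN. Qed.

Lemma smod_act x w a : mact (smod k x w) a = wmx true w a.
Proof.
have nthE (l : letter Q) i : (i < size w)%N && (nth l w i == l) = (onth w i == Some l).
  have [lt|ge] := ltnP i (size w); last by rewrite onth_default.
  have [l' e] := onth_ex lt; rewrite (onth_nth _ _ _ _ e) e /=.
  by apply/eqP/eqP => [->|[]].
apply/matrixP => p q; rewrite !mxE /walk -!nthE; congr (nat_of_bool (_ || _))%:R.
  by rewrite -andbA andbCA.
by rewrite -andbA andbCA.
Qed.

Lemma smod_actE x w a (p q : 'I_(size w).+1) :
  mact (smod k x w) a p q = (walk true w a p q)%:R.
Proof. by rewrite smod_act mxE. Qed.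

Lemma smod_idemE x w v (p q : 'I_(size w).+1) :
  midem (smod k x w) v p q = ((p == q) && (svert x w p == v))%:R.
Proof. by rewrite mxE. Qed.

Lemma smod_idem_mull x w v m (A : 'M[k]_((size w).+1, m)) (p : 'I_(size w).+1) q :
  (midem (smod k x w) v *m A) p q = (svert x w p == v)%:R * A p q.
Proof.
rewrite mxE (sum_only (i := p)) => [|r rp]; rewrite smod_idemE ?eqxx //.
by rewrite eq_sym (negbTE rp) mul0r.
Qed.

Lemma smod_idem_mulr x w v m (A : 'M[k]_(m, (size w).+1)) p (q : 'I_(size w).+1) :
  (A *m midem (smod k x w) v) p q = A p q * (svert x w q == v)%:R.
Proof.
rewrite mxE (sum_only (i := q)) => [|r rp]; rewrite smod_idemE ?eqxx //.
by rewrite (negbTE rp) mulr0.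
Qed.

Lemma wmx_mull x s w a m (A : 'M[k]_((size w).+1, m)) (p : 'I_(size w).+1) q r :
  is_string x w -> walk s w a p (r : 'I_(size w).+1) -> (wmx s w a *m A) p q = A r q.
Proof.
move=> st wr; rewrite mxE (sum_only (i := r)) => [|t tr]; first by rewrite mxE wr mul1r.
rewrite mxE; case: (boolP (walk _ _ _ _ _)) => [wt|]; last by rewrite mul0r.
by case/eqP: tr; apply: val_inj; rewrite /= (walk_fun st wr wt).
Qed.

Lemma wmx_mull0 s w a m (A : 'M[k]_((size w).+1, m)) (p : 'I_(size w).+1) q :
  (forall r : 'I_(size w).+1, ~~ walk s w a p r) -> (wmx s w a *m A) p q = 0.
Proof. by move=> H; rewrite mxE big1 // => r _; rewrite mxE (negbTE (H r)) mul0r. Qed.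

Lemma wmx_mulr x s w a m (A : 'M[k]_(m, (size w).+1)) p (q : 'I_(size w).+1) r :
  is_string x w -> walk s w a (r : 'I_(size w).+1) q -> (A *m wmx s w a) p q = A p r.
Proof.
move=> st wr; rewrite mxE (sum_only (i := r)) => [|t tr]; first by rewrite mxE wr mulr1.
rewrite mxE; case: (boolP (walk _ _ _ _ _)) => [wt|]; last by rewrite mulr0.
by case/eqP: tr; apply: val_inj; rewrite /= (walk_inj st wr wt).
Qed.

Lemma smod_module x w : is_string x w -> is_module (smod k x w).
Proof.
move=> st; split=> [v|v v' vv'||a|a b ab]; apply/matrixP => p q.
- rewrite smod_idem_mull smod_idemE.
  by case: eqP => _; rewrite ?andbF ?mul1r ?mul0r.
- rewrite smod_idem_mull smod_idemE mxE; case: eqP => [->|_]; last by rewrite mul0r.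
  by rewrite (negbTE vv') andbF mulr0.
- rewrite summxE (sum_only (i := svert x w p)) => [|v vp]; rewrite smod_idemE.
    by rewrite eqxx andbT mxE.
  by rewrite [_ == v]eq_sym (negbTE vp) andbF.
- rewrite smod_idem_mulr smod_idem_mull smod_actE.
  case: (boolP (walk _ _ _ _ _)) => h; last by rewrite mulr0 mul0r.
  by rewrite (walk_src st h) (walk_tgt st h) !eqxx !mul1r.
- rewrite [RHS]mxE.
  have [|H] := pickP (fun r : 'I_(size w).+1 => walk true w a p r); last first.
    by rewrite !smod_act wmx_mull0 // => r; rewrite H.
  move=> r pr; rewrite !smod_act (wmx_mull _ _ st pr) mxE.
  (* Two steps in the same direction along the word spell the relation, which a string excludes.
     Steps in opposite directions use one letter with both signs. *)
  case: (boolP (walk _ _ _ _ _)) => // rq; exfalso; move: pr rq.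
  move=> /orP[] /andP[/eqP h /eqP e] /orP[] /andP[/eqP h' /eqP e'].
  + rewrite h in e'; have [_ _ H _] := string_next st e e'.
    by apply: H.
  + by move: e'; have [<-] : (p : nat) = q by [rewrite h in h'; case: h']; rewrite e.
  + by move: e'; rewrite e.
  + rewrite h' in e; have [_ _ _ H] := string_next st e' e.
    by apply: H.
Qed.

End StringModules.

(** * Coordinate subquotients *)

Section Coordinates.
Variables (k : fieldType) (Q : bquiver).
Implicit Types X Y Z K C : rmod k Q.

Definition sel_mx m n (g : 'I_m -> 'I_n) : 'M[k]_(m, n) := \matrix_(i, j) (g i == j)%:R.

Lemma sel_mx_mull m n p (g : 'I_m -> 'I_n) (A : 'M[k]_(n, p)) i j :
  (sel_mx g *m A) i j = A (g i) j.
Proof.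
rewrite mxE (sum_only (i := g i)) => [|r rg]; rewrite mxE ?eqxx ?mul1r //.
by rewrite eq_sym (negbTE rg) mul0r.
Qed.

Lemma sel_mx_mulr m n p (g : 'I_m -> 'I_n) (A : 'M[k]_(p, n)) i j :
  (A *m (sel_mx g)^T) i j = A i (g j).
Proof.
rewrite mxE (sum_only (i := g j)) => [|r rg]; rewrite !mxE ?eqxx ?mulr1 //.
by rewrite eq_sym (negbTE rg) mulr0.
Qed.

Lemma sel_mxK m n (g : 'I_m -> 'I_n) : injective g -> sel_mx g *m (sel_mx g)^T = 1%:M.
Proof.
move=> gI; apply/matrixP => i j.
by rewrite sel_mx_mull !mxE (inj_eq gI) eq_sym.
Qed.

Lemma sel_mxP m n (g : 'I_m -> 'I_n) : injective g -> forall i j,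
  ((sel_mx g)^T *m sel_mx g) i j = ((i == j) && (i \in codom g))%:R.
Proof.
move=> gI i j; rewrite mxE; case: (boolP (i \in codom g)) => [/codomP[r ->]|ni].
  rewrite (sum_only (i := r)) => [|s sr]; rewrite !mxE ?eqxx ?mul1r ?andbT //.
  by rewrite (inj_eq gI) (negbTE sr) mul0r.
rewrite andbF big1 // => r _; rewrite !mxE; case: eqP => [e|_]; last by rewrite mul0r.
by case/negP: ni; rewrite -e codom_f.
Qed.

Lemma sel_mx_free m n (g : 'I_m -> 'I_n) : injective g -> row_free (sel_mx g).
Proof. by move=> gI; apply/row_freeP; exists (sel_mx g)^T; exact: sel_mxK. Qed.

Lemma sel_mx_full m n (g : 'I_m -> 'I_n) : injective g -> row_full (sel_mx g)^T.
Proof. by move=> gI; apply/row_fullP; exists (sel_mx g); exact: sel_mxK. Qed.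

(** The compression of [X] to the coordinates chosen by [g]. It represents a submodule if these
    coordinates span one, and a quotient if the remaining ones do, so kernels, images and cokernels
    share one form. *)
Definition restr X m (g : 'I_m -> 'I_(mdim X)) : rmod k Q :=
  @RMod k Q m (fun v => sel_mx g *m midem X v *m (sel_mx g)^T)
              (fun a => sel_mx g *m mact X a *m (sel_mx g)^T).

Lemma restr_sub X m (g : 'I_m -> 'I_(mdim X)) K (i : 'M_(mdim K, mdim X)) :
  injective g -> is_hom i -> row_free i -> (i :=: sel_mx g)%MS -> iso (restr g) K.
Proof.
move=> gI [i1 i2] fi ei.
have st A : (i *m A <= i)%MS -> sel_mx g *m A *m (sel_mx g)^T *m sel_mx g = sel_mx g *m A.
  move=> s; have : (sel_mx g *m A <= sel_mx g)%MS.
    rewrite -(eqmxMr _ ei); apply: submx_trans s _.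
    by rewrite ei.
  by move=> /submxP[D ->]; rewrite -(mulmxA D) sel_mxK // mulmx1.
have hs : @is_hom k Q (restr g) X (sel_mx g).
  by split=> a /=; apply: st; rewrite -?i1 -?i2 submxMl.
have [u [hu ui]] : exists u : 'M_(mdim (restr g), mdim K), is_hom u /\ u *m i = sel_mx g.
  by apply: hom_factor_sub => //; rewrite ei.
exists u; split=> //; first by apply: (@row_free_mull _ _ _ _ u i); rewrite ui sel_mx_free.
rewrite /row_full -(mxrankMfree u fi) ui -ei.
by move: fi; rewrite /row_free.
Qed.

Lemma restr_quo X m (g : 'I_m -> 'I_(mdim X)) C (c : 'M_(mdim X, mdim C)) :
  injective g -> is_hom c -> row_full c -> (kermx c :=: kermx (sel_mx g)^T)%MS ->
  iso (restr g) C.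
Proof.
move=> gI [c1 c2] uc ec.
(* [P] projects onto the coordinates outside [g], whose span is the kernel of [c]. *)
pose P := (1%:M - (sel_mx g)^T *m sel_mx g).
have Pg : P *m (sel_mx g)^T = 0 by rewrite mulmxBl -mulmxA sel_mxK // mulmx1 mul1mx subrr.
have Pc : P *m c = 0 by apply/eqP; rewrite -sub_kermx ec sub_kermx Pg.
have st A (B : 'M_(mdim C)) : A *m c = c *m B ->
    A *m (sel_mx g)^T = (sel_mx g)^T *m (sel_mx g *m A *m (sel_mx g)^T).
  move=> e; apply/eqP; rewrite -subr_eq0 !mulmxA -mulmxBl -[X in X - _]mul1mx -mulmxBl.
  by rewrite -sub_kermx -ec sub_kermx -mulmxA e mulmxA Pc mul0mx.
have hs : @is_hom k Q X (restr g) (sel_mx g)^T.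
  by split=> a /=; [exact: st (c1 a) | exact: st (c2 a)].
have [u [hu cu]] : exists u : 'M_(mdim C, mdim (restr g)), is_hom u /\ c *m u = (sel_mx g)^T.
  by apply: hom_factor_quo => //; rewrite ec.
apply: iso_sym; exists u; split=> //; last first.
  by apply: (@row_full_mulr _ _ _ _ c u); rewrite cu sel_mx_full.
apply: inj_row_free => v vu0; have [c' c'c] := row_fullP uc.
apply/eqP; rewrite -[v]mulmx1 -c'c mulmxA -sub_kermx ec sub_kermx -cu mulmxA -(mulmxA v).
by rewrite c'c mulmx1 vu0.
Qed.

(** No idempotent or arrow has an entry between the two blocks, so the permutation matrix [F] that
    sorts the coordinates is an isomorphism, with inverse [F^T]. *)
Lemma restr_split X m (g : 'I_m -> 'I_(mdim X)) m1 (g1 : 'I_m1 -> 'I_(mdim X))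
    m2 (g2 : 'I_m2 -> 'I_(mdim X)) :
  injective g -> injective g1 -> injective g2 ->
  (forall j, (j \in codom g) = (j \in codom g1) || (j \in codom g2)) ->
  (forall i j, g1 i != g2 j) ->
  (forall v i j, midem X v (g1 i) (g2 j) = 0 /\ midem X v (g2 j) (g1 i) = 0) ->
  (forall a i j, mact X a (g1 i) (g2 j) = 0 /\ mact X a (g2 j) (g1 i) = 0) ->
  iso (restr g) (dsum (restr g1) (restr g2)).
Proof.
move=> gI g1I g2I cod dis idE actE.
pose F := sel_mx g *m row_mx (sel_mx g1)^T (sel_mx g2)^T.
have P12 : (sel_mx g)^T *m sel_mx g = (sel_mx g1)^T *m sel_mx g1 + (sel_mx g2)^T *m sel_mx g2.
  apply/matrixP => i j; rewrite [RHS]mxE !sel_mxP // cod -natrD.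
  case: (boolP (i \in codom g1)) => [/codomP[r ->]|_]; last by rewrite andbF.
  case: (boolP (_ \in codom g2)) => [/codomP[s e]|_]; last by rewrite !andbF addn0.
  by have := dis r s; rewrite e eqxx.
have s12 : sel_mx g1 *m (sel_mx g2)^T = 0.
  by apply/matrixP => i j; rewrite sel_mx_mulr !mxE (negbTE (dis i j)).
have s21 : sel_mx g2 *m (sel_mx g1)^T = 0.
  by apply: trmx_inj; rewrite trmx_mul trmxK s12 !trmx0.
have gX p (A : 'M_(_, p)) :
    sel_mx g *m A = sel_mx g *m ((sel_mx g1)^T *m (sel_mx g1 *m A)) + sel_mx g *m ((sel_mx g2)^T *m (sel_mx g2 *m A)).
  by rewrite -mulmxDr !mulmxA -mulmxDl -P12 !mulmxA sel_mxK // mul1mx.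
have PT1 : (sel_mx g)^T *m (sel_mx g *m (sel_mx g1)^T) = (sel_mx g1)^T.
  by rewrite mulmxA P12 mulmxDl -!mulmxA sel_mxK // s21 mulmx1 mulmx0 addr0.
have PT2 : (sel_mx g)^T *m (sel_mx g *m (sel_mx g2)^T) = (sel_mx g2)^T.
  by rewrite mulmxA P12 mulmxDl -!mulmxA sel_mxK // s12 mulmx1 mulmx0 add0r.
have key (A : 'M[k]_(mdim X)) : (forall i j, A (g1 i) (g2 j) = 0 /\ A (g2 j) (g1 i) = 0) ->
    (sel_mx g *m A *m (sel_mx g)^T) *m F = F *m
      block_mx (sel_mx g1 *m A *m (sel_mx g1)^T) 0 0 (sel_mx g2 *m A *m (sel_mx g2)^T).
  move=> H.
  have A12 : sel_mx g1 *m A *m (sel_mx g2)^T = 0.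
    by apply/matrixP => i j; rewrite sel_mx_mulr sel_mx_mull mxE; case: (H i j).
  have A21 : sel_mx g2 *m A *m (sel_mx g1)^T = 0.
    by apply/matrixP => i j; rewrite sel_mx_mulr sel_mx_mull mxE; case: (H j i).
  rewrite /F !mul_mx_row mul_row_block !mulmx0 addr0 add0r -!mulmxA PT1 PT2.
  rewrite (gX _ (A *m (sel_mx g1)^T)) (gX _ (A *m (sel_mx g2)^T)).
  by rewrite -!mulmxA in A12 A21 *; rewrite A12 A21 !mulmx0 addr0 add0r.
have F1 : F *m F^T = 1%:M.
  rewrite /F trmx_mul mulmxA -(mulmxA (sel_mx g)) tr_row_mx !trmxK mul_row_col -P12.
  by rewrite mulmxA sel_mxK // mul1mx sel_mxK.
have F2 : F^T *m F = 1%:M.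
  rewrite /F trmx_mul mulmxA -(mulmxA _ _ (sel_mx g)) P12 tr_row_mx !trmxK.
  rewrite mul_col_mx mul_col_row !mulmxDr !mulmxA !sel_mxK // s12 s21 !mul1mx !mul0mx.
  rewrite addr0 add0r !sel_mxK // s12 s21.
  by rewrite [RHS]scalar_mx_block.
exists F; split; [split=> a /=; apply: key => i j | apply/row_freeP | apply/row_fullP].
- exact: idE.
- exact: actE.
- by exists F^T.
- by exists F^T.
Qed.

End Coordinates.

(** * Sets of positions in a string as sums of substrings *)

Section Substrings.
Variables (k : fieldType) (Q : bquiver).
Implicit Types (x v : vtx Q) (w : seq (letter Q)) (l : letter Q) (a b : arr Q).
Local Arguments smod : simpl never.

Lemma restrE (X : rmod k Q) m (g : 'I_m -> 'I_(mdim X)) :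
  (forall v i j, midem (restr g) v i j = midem X v (g i) (g j)) /\
  (forall a i j, mact (restr g) a i j = mact X a (g i) (g j)).
Proof. by split=> ? i j; rewrite /= sel_mx_mulr sel_mx_mull. Qed.

Lemma walk_sub s w p n a i j : (i <= n)%N -> (j <= n)%N ->
  walk s (take n (drop p w)) a i j = walk s w a (p + i) (p + j).
Proof.
move=> ni nj; rewrite /walk !onth_take !onth_drop -!addnS !eqn_add2l.
congr (_ || _); [case: (eqVneq j) => //= e | case: (eqVneq i) => //= e].
  by rewrite ifT // -e.
by rewrite ifT // -e.
Qed.

Lemma restr_interval x w p n
    (g : 'I_(size (take n (drop p w))).+1 -> 'I_(mdim (smod k x w))) :
  (p + n <= size w)%N -> (forall i, g i = (p + i)%N :> nat) ->
  iso (restr g) (smod k (svert x w p) (take n (drop p w))).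
Proof.
move=> le gE.
have sz : size (take n (drop p w)) = n.
  by apply: size_takel; rewrite size_drop; lia.
have [rI rA] := restrE g.
have le_n (i : 'I_(size (take n (drop p w))).+1) : (i <= n)%N.
  by have := ltn_ord i; rewrite {2}sz.
have eI v : midem (restr g) v = midem (smod k (svert x w p) (take n (drop p w))) v.
  apply/matrixP => i j; rewrite rI !smod_idemE -val_eqE /= !gE eqn_add2l val_eqE.
  by rewrite svert_sub //; have := le_n i; lia.
have eA a : mact (restr g) a = mact (smod k (svert x w p) (take n (drop p w))) a.
  by apply/matrixP => i j; rewrite rA !smod_actE !gE walk_sub.
exists (1%:M : 'M[k]_((size (take n (drop p w))).+1)); split.
- by split=> a; rewrite ?eI ?eA mulmx1 mul1mx.
- by rewrite row_free_unit unitmx1.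
- by rewrite row_full_unit unitmx1.
Qed.

Variable B : vtx Q * seq (letter Q) -> Prop.
Hypothesis B_sub : forall x w p n, B (x, w) -> (p <= size w)%N ->
  B (svert x w p, take n (drop p w)).

Notation M := (fun p => smod k p.1 p.2).

(** Arrows join neighbouring positions only, so each maximal run of consecutive positions splits off
    as the string module of a substring. The induction peels off the first run. *)
Lemma restr_in_add x w m (g : 'I_m -> 'I_(mdim (smod k x w))) :
  B (x, w) -> injective g -> exists s : seq (vtx Q * seq (letter Q)),
  (forall p, p \in s -> B p) /\ iso (restr g) (bigsum [seq M p | p <- s]).
Proof.
move=> Bw; elim/ltn_ind: m g => m IH g gI.
case: m => [|m] in IH g gI *.
  exists [::]; split=> //; exists (0 : 'M_0); split; first exact: hom0.
    by rewrite /row_free mxrank0.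
  by rewrite /row_full mxrank0.
pose inA (j : nat) := [exists i, g i == j :> nat].
have inAP j : reflect (exists i, g i = j :> nat) (inA j).
  by apply: (iffP existsP) => -[i /eqP e]; exists i.
have exA : exists j, inA j by exists (g ord0); apply/inAP; exists ord0.
case: (ex_minnP exA) => p pA pmin.
(* For the least such [n], the first run consists of the positions from [p] to [p + n] inclusive. *)
have exB : exists n, ~~ inA (p + n.+1)%N.
  exists (size w); apply/inAP => -[i e].
  by have := ltn_ord (g i); rewrite e /= addnS ltnS; lia.
case: (ex_minnP exB) => n nB nmin.
have runA i : (i <= n)%N -> inA (p + i)%N.
  case: i => [|i] le; first by rewrite addn0.
  by case: (boolP (inA (p + i.+1)%N)) => // /nmin; rewrite leqNgt le.
have szA j : inA j -> (j <= size w)%N by move=> /inAP[i <-]; rewrite -ltnS ltn_ord.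
have le : (p + n <= size w)%N by apply: szA; exact: runA.
have sz : size (take n (drop p w)) = n.
  by apply: size_takel; rewrite size_drop; lia.
pose g1 (i : 'I_(size (take n (drop p w))).+1) : 'I_(mdim (smod k x w)) :=
  inord (n' := size w) (p + i).
have g1E i : g1 i = (p + i)%N :> nat.
  by rewrite /g1 inordK //; have := ltn_ord i; rewrite {2}sz; lia.
pose A2 := [set j in codom g | (p + n < j)%N].
pose g2 (i : 'I_#|A2|) : 'I_(mdim (smod k x w)) := enum_val i.
have g2P i : inA (g2 i) /\ (p + n < g2 i)%N.
  have := enum_valP i; rewrite inE => /andP[/codomP[r e] lt]; split=> //.
  by apply/inAP; exists r; rewrite -e.
have g1I : injective g1.
  by move=> i j /(congr1 val) /=; rewrite !g1E => /addnI; exact: val_inj.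
have g2I : injective g2 by exact: enum_val_inj.
have g1n (i : 'I_(size (take n (drop p w))).+1) : (i <= n)%N.
  by have := ltn_ord i; rewrite {2}sz.
have cardA2 : (#|A2| < m.+1)%N.
  have <- : #|codom g| = m.+1 by rewrite card_codom // card_ord.
  apply: proper_card; apply/properP; split; first by apply/subsetP => j; rewrite inE => /andP[].
  have /inAP[i e] := pA; exists (g i); first exact: codom_f.
  by rewrite inE e codom_f /=; lia.
have [s [sB siso]] := IH _ cardA2 g2 g2I.
(* The position [p + n.+1] is missing, so the remaining positions are not even adjacent to the
   run. *)
have far (i : nat) j : (p + i < g2 j)%N /\ (i <= n -> (p + i).+1 != g2 j)%N \/ (n < i)%N.
  have [iA lt] := g2P j.
  have [le_i|lt_i] := leqP i n; [left|by right]; split=> [|_]; first lia.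
  apply/eqP => e; case/negP: nB; have <- : g2 j = (p + n.+1)%N :> nat; [lia|done].
exists ((svert x w p, take n (drop p w)) :: s); split.
  by move=> q; rewrite inE => /orP[/eqP ->|/sB //]; apply: B_sub => //; lia.
apply: (@iso_trans _ _ _ (dsum (restr g1) (restr g2))); last first.
  have [f [hf ff uf]] := restr_interval le g1E; have [h [hh fh uh]] := siso.
  have [f' [hf' f'f ff']] := hom_inv hf ff uf; have [h' [hh' h'h hh'']] := hom_inv hh fh uh.
  exists (block_mx f 0 0 h); split.
  - split=> a /=; rewrite !mulmx_block !mulmx0 !mul0mx !addr0 !add0r.
      by case: hf => -> _; case: hh => -> _.
    by case: hf => _ ->; case: hh => _ ->.
  - apply/row_freeP; exists (block_mx f' 0 0 h').
    by rewrite mulmx_block !mulmx0 !mul0mx !addr0 !add0r ff' hh'' -scalar_mx_block.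
  - apply/row_fullP; exists (block_mx f' 0 0 h').
    by rewrite mulmx_block !mulmx0 !mul0mx !addr0 !add0r f'f h'h -scalar_mx_block.
have sep i j : (g1 i < g2 j)%N /\ (g1 i).+1 != g2 j.
  have [[lt ne]|] := far i j; last by rewrite ltnNge g1n.
  by rewrite g1E; split=> //; apply: ne.
apply: restr_split => //.
- move=> j; apply/codomP/orP => [[r e]|[/codomP[r e]|/codomP[r e]]].
  + have jA : inA j by apply/inAP; exists r; rewrite e.
    have [le_j|lt_j] := leqP j (p + n); last first.
      by right; apply/codomP; have jA2 : j \in A2 by [rewrite inE e codom_f -e];
         exists (enum_rank_in jA2 j); rewrite /g2 enum_rankK_in.
    left; apply/codomP; have lt : (j - p < (size (take n (drop p w))).+1)%N by rewrite sz; lia.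
    exists (Ordinal lt); apply: val_inj; rewrite /= g1E /= subnKC //; exact: pmin.
  + have : inA j by rewrite e g1E; apply: runA; exact: g1n.
    by move=> /inAP[i e']; exists i; apply: val_inj.
  + have [] : inA j /\ (p + n < j)%N by rewrite e; exact: g2P.
    by move=> /inAP[i e'] _; exists i; apply: val_inj.
- by move=> i j; apply/eqP => /(congr1 val) /= e; have [] := sep i j; rewrite e ltnn.
- move=> v i j; have [lt _] := sep i j; rewrite !smod_idemE.
  by rewrite -!val_eqE /= [_ == nat_of_ord (g1 i)]eq_sym; case: eqP lt => //= ->; rewrite ltnn.
- move=> a i j; have [lt ne] := sep i j; rewrite !smod_actE /walk.
  have /negbTE e1 : (g2 j : nat) != (g1 i).+1 by rewrite eq_sym.
  have /negbTE e2 : (g1 i : nat) != (g2 j).+1 by lia.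
  by rewrite e1 e2.
Qed.

End Substrings.

(** * Homomorphisms between thin string modules *)

Section CoordinateSpaces.
Variable k : fieldType.

Lemma exact_eqmx m1 m2 n p (f : 'M[k]_(m1, n)) (g : 'M_(m2, n)) (c : 'M_(n, p)) :
  exact f c -> exact g c -> (f :=: g)%MS.
Proof.
move=> ef eg; apply/eqmxP/andP; split; first by rewrite eg (exact_mul0 ef).
by rewrite ef (exact_mul0 eg).
Qed.

Definition coord_mx n (A : {set 'I_n}) : 'M[k]_(#|A|, n) := sel_mx k (@enum_val _ A).

Lemma coord_mxP n (A : {set 'I_n}) m (v : 'M_(m, n)) :
  (v <= coord_mx A)%MS <-> forall i j, j \notin A -> v i j = 0.
Proof.
split=> [/submxP[D ->] i j jA|H].
  rewrite mxE big1 // => r _; rewrite mxE; case: eqP => [e|_]; last by rewrite mulr0.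
  by case/negP: jA; rewrite -e; exact: enum_valP.
apply/submxP; exists (v *m (coord_mx A)^T); rewrite -mulmxA; apply/matrixP => i j.
rewrite mxE (sum_only (i := j)) => [|r rj]; rewrite sel_mxP ?eqxx; try exact: enum_val_inj.
  have [jA|jA] := boolP (j \in A); last by rewrite (H _ _ jA) mul0r.
  suff -> : j \in codom (@enum_val _ A) by rewrite mulr1.
  by apply/codomP; exists (enum_rank_in jA j); rewrite enum_rankK_in.
by rewrite (negbTE rj) mulr0.
Qed.

Lemma coord_mx_exact n (A : {set 'I_n}) : exact (coord_mx A) (coord_mx (~: A))^T.
Proof.
move=> m v; apply/idP/eqP => [/coord_mxP H|H].
  apply/matrixP => i j; rewrite sel_mx_mulr mxE; apply: H.
  by have := enum_valP j; rewrite inE.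
apply/coord_mxP => i j jA; have jA' : j \in ~: A by rewrite inE.
have /matrixP/(_ i (enum_rank_in jA' j)) := H.
by rewrite sel_mx_mulr mxE enum_rankK_in.
Qed.

End CoordinateSpaces.

Section ThinHom.
Variables (k : fieldType) (Q : bquiver).
Implicit Types (x v : vtx Q) (w : seq (letter Q)) (l : letter Q) (a b : arr Q).
Local Arguments smod : simpl never.

Variable B : vtx Q * seq (letter Q) -> Prop.
Hypothesis B_sub : forall x w p n, B (x, w) -> (p <= size w)%N ->
  B (svert x w p, take n (drop p w)).
Hypothesis B_thin : forall x w i j, B (x, w) -> (i <= size w)%N -> (j <= size w)%N ->
  svert x w i = svert x w j -> i = j.

Notation M := (fun p => smod k p.1 p.2).

Section Hom.
Variables p q : vtx Q * seq (letter Q).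
Hypotheses (Bp : B p) (Bq : B q).
Variable f : 'M[k]_(mdim (M p), mdim (M q)).
Hypothesis hf : is_hom f.

Lemma thin_hom_vert i j : f i j != 0 -> svert p.1 p.2 i = svert q.1 q.2 j.
Proof.
case: hf => H _; have /matrixP/(_ i j) := H (svert p.1 p.2 i).
rewrite smod_idem_mull smod_idem_mulr eqxx mul1r.
by case: eqP => [-> //|_]; rewrite mulr0 => ->; rewrite eqxx.
Qed.

(** A nonzero entry joins equal vertices, and the vertices of [q] are distinct. With [thin_hom_col],
    each row and column has at most one nonzero entry, so kernel and image are coordinate
    subspaces. *)
Lemma thin_hom_row i j j' : f i j != 0 -> j' != j -> f i j' = 0.
Proof.
move=> /thin_hom_vert e ne; apply/eqP/idPn => /thin_hom_vert e'.
case/eqP: ne; apply: val_inj; case: q Bq j j' e e' => y u Bu j j' /= e e'.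
by apply: (B_thin Bu); rewrite -1?ltnS ?ltn_ord // -e.
Qed.

Lemma thin_hom_col i j i' : f i j != 0 -> i' != i -> f i' j = 0.
Proof.
move=> /thin_hom_vert e ne; apply/eqP/idPn => /thin_hom_vert e'.
case/eqP: ne; apply: val_inj; case: p Bp i i' e e' => y u Bu i i' /= e e'.
by apply: (B_thin Bu); rewrite -1?ltnS ?ltn_ord // e.
Qed.

Lemma thin_ker : exact (coord_mx k [set i | row i f == 0]) f.
Proof.
apply: exactI => [|v vf0].
  apply/matrixP => i j; rewrite sel_mx_mull [RHS]mxE; have := enum_valP i.
  by rewrite inE => /eqP/rowP/(_ j); rewrite !mxE.
apply/coord_mxP => r i; rewrite inE => /rV0Pn[j]; rewrite mxE => fij.
have /matrixP/(_ r j) := vf0.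
rewrite mxE (sum_only (i := i)) => [|s si]; last by rewrite (thin_hom_col fij si) mulr0.
by move/eqP; rewrite [X in _ == X]mxE mulf_eq0 (negbTE fij) orbF => /eqP.
Qed.

Lemma thin_im : (f :=: coord_mx k [set j | [exists i, f i j != 0%R]])%MS.
Proof.
apply/eqmxP/andP; split.
  apply/coord_mxP => i j; rewrite inE => /existsPn/(_ i).
  by rewrite negbK => /eqP.
apply/row_subP => r; have := enum_valP r; rewrite inE => /existsP[i fi].
apply/submxP; exists ((f i (enum_val r))^-1 *: delta_mx 0 i).
rewrite -scalemxAl -rowE; apply/rowP => j; rewrite !mxE.
case: (eqVneq (enum_val r) j) => [<-|ne]; first by rewrite mulVf.
by rewrite (thin_hom_row fi (j' := j)) ?mulr0 1?eq_sym.
Qed.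

End Hom.

Lemma restr_in_add_iso p (A : {set 'I_(mdim (M p))}) C : B p -> is_module C ->
  iso (restr (X := M p) (@enum_val _ A)) C -> in_add M B C.
Proof.
move=> Bp mC h; split=> //.
have Bp' : B (p.1, p.2) by case: p A Bp h.
have [s [sB siso]] := restr_in_add B_sub Bp' (@enum_val_inj _ A).
by exists s; split=> //; apply: iso_trans siso; exact: iso_sym.
Qed.

Lemma thin_ker_in_add p q (f : 'M_(mdim (M p), mdim (M q))) K (i : 'M_(mdim K, _)) :
  B p -> B q -> is_hom f -> is_module K -> is_hom i -> row_free i -> exact i f -> in_add M B K.
Proof.
move=> Bp Bq hf mK hi fi ei; apply: (restr_in_add_iso Bp mK).
apply: (restr_sub (i := i)) => //; first exact: enum_val_inj.
exact: exact_eqmx ei (thin_ker Bp hf).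
Qed.

Lemma thin_im_in_add p q (f : 'M_(mdim (M p), mdim (M q))) J (j : 'M_(mdim J, _)) :
  B p -> B q -> is_hom f -> is_module J -> is_hom j -> row_free j -> (j :=: f)%MS -> in_add M B J.
Proof.
move=> Bp Bq hf mJ hj fj ej; apply: (restr_in_add_iso Bq mJ).
apply: (restr_sub (i := j)) => //; first exact: enum_val_inj.
exact: eqmx_trans ej (thin_im Bq hf).
Qed.

Lemma thin_coker_in_add p q (f : 'M_(mdim (M p), mdim (M q))) C (c : 'M_(_, mdim C)) :
  B p -> B q -> is_hom f -> is_module C -> is_hom c -> row_full c -> exact f c -> in_add M B C.
Proof.
move=> Bp Bq hf mC hc uc ec.
pose A := [set j | [exists i, f i j != 0]].
apply: (@restr_in_add_iso q (~: A) C Bq mC).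
apply: (@restr_quo _ _ (M q) _ _ C c (@enum_val_inj _ _) hc uc).
apply: eqmx_trans (exact_eqmx (@exact_kermx _ _ _ c) ec) _.
apply: eqmx_trans (thin_im Bq hf) _.
exact: exact_eqmx (coord_mx_exact A) (@exact_kermx _ _ _ _).
Qed.

End ThinHom.

(** * Strings of a brick algebra have distinct vertices *)

Section Indecomposable.
Variables (k : fieldType) (Q : bquiver).

(** The projection onto one summand of a proper decomposition would be an idempotent other than 0
    and 1. *)
Lemma indecomposable_idem (X : rmod k Q) : is_module X -> (0 < mdim X)%N ->
  (forall f : 'M_(mdim X), @is_hom k Q X X f -> f *m f = f -> f = 0 \/ f = 1%:M) ->
  indecomposable X.
Proof.
move=> mX X0 H; split=> // -[Y [Z [mY mZ Y0 Z0 [u [hu fu uu]]]]].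
have [v [hv vu uv]] := hom_inv hu fu uu.
pose c : 'M[k]_(mdim Y + mdim Z) := block_mx 1%:M 0 0 0.
have hc : @is_hom k Q (dsum Y Z) (dsum Y Z) c.
  by split=> a /=; rewrite !mulmx_block !mulmx0 !mul0mx !addr0 mulmx1 mul1mx.
have cc : c *m c = c.
  by rewrite mulmx_block !mulmx0 !mul0mx !addr0 mulmx1.
have ce : v *m (u *m c *m v) *m u = c.
  by rewrite !mulmxA vu mul1mx -mulmxA vu mulmx1.
have [||e|e] := H (u *m c *m v).
- exact: (hom_mul (hom_mul hu hc) hv).
- by rewrite -!mulmxA (mulmxA v u) vu mul1mx (mulmxA c c) cc.
- have : c = 0 by rewrite -ce e mulmx0 mul0mx.
  rewrite -[RHS]block_mx0 => /eq_block_mx[/eqP e1 _ _ _].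
  by have := one_neq0 (X := Y) Y0; rewrite e1.
- have : c = 1%:M by rewrite -ce e mulmx1.
  rewrite [RHS]scalar_mx_block => /eq_block_mx[_ _ _ /esym /eqP e1].
  by have := one_neq0 (X := Z) Z0; rewrite e1.
Qed.

(** The constant diagonal entry is an idempotent of the field, hence 0 or 1. So [1 - N] or [N] is
    unitriangular, and an invertible idempotent is the identity. *)
Lemma trig_idem n (N : 'M[k]_n.+1) : is_trig_mx N -> (forall i, N i i = N ord0 ord0) ->
  N *m N = N -> N = 0 \/ N = 1%:M.
Proof.
have unit_idem (A : 'M[k]_n.+1) : is_trig_mx A -> (forall i, A i i = 1) -> A *m A = A -> A = 1%:M.
  move=> tA dA AA; have uA : A \in unitmx.
    by rewrite unitmxE det_trig // big1 ?unitr1.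
  by rewrite -[LHS](mulKmx uA) AA mulVmx.
move=> tN dN NN.
have : N ord0 ord0 * N ord0 ord0 = N ord0 ord0.
  have /matrixP/(_ ord0 ord0) := NN; rewrite mxE (sum_only (i := ord0)) // => j j0.
  by move/is_trig_mxP: tN => -> //; [rewrite mul0r | rewrite lt0n].
move/eqP; rewrite -subr_eq0 -{3}[N ord0 ord0]mulr1 -mulrBr mulf_eq0 subr_eq0.
case/orP=> /eqP N0; last by right; apply: unit_idem => // i; rewrite dN.
left; apply/eqP; rewrite -[N]opprK oppr_eq0 -(addrK 1%:M (- N)) subr_eq0 addrC.
apply/eqP; apply: unit_idem => [|i|].
- apply/is_trig_mxP => i j ij; rewrite !mxE; move/is_trig_mxP: tN => -> //.
  by rewrite -val_eqE /= ltn_eqF // subr0.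
- by rewrite !mxE eqxx dN N0 subr0.
- by rewrite mulmxBl mul1mx mulmxBr mulmx1 NN subrr subr0.
Qed.

End Indecomposable.

(** * Closed walks and nilpotent endomorphisms *)

Section ClosedWalk.
Variables (k : fieldType) (Q : bquiver).
Implicit Types (x v : vtx Q) (w : seq (letter Q)) (l : letter Q) (a b : arr Q).
Local Arguments smod : simpl never.

(* Transposing exchanges the roles of the two signs, so that only one of them has
   to be treated in [closed_walk_absurd]. *)
Definition twist n (s : bool) (A : 'M[k]_n) := if s then A else A^T.

Lemma smod_homP s x w (f : 'M[k]_((size w).+1)) :
  @is_hom k Q (smod k x w) (smod k x w) (twist s f) <->
  (forall p q, f p q != 0 -> svert x w p = svert x w q) /\
  (forall a, wmx k s w a *m f = f *m wmx k s w a).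
Proof.
have idP (g : 'M[k]_((size w).+1)) : (forall v, midem (smod k x w) v *m g = g *m midem (smod k x w) v) <->
   (forall p q, g p q != 0 -> svert x w p = svert x w q).
  split=> H => [p q|v].
    have /matrixP/(_ p q) := H (svert x w p).
    rewrite smod_idem_mull smod_idem_mulr eqxx mul1r.
    by case: eqP => [-> //|_]; rewrite mulr0 => ->; rewrite eqxx.
  apply/matrixP => p q; rewrite smod_idem_mull smod_idem_mulr.
  have [->|/H ->] := eqVneq (g p q) 0; first by rewrite mulr0 mul0r.
  by rewrite mulrC.
have idT : (forall p q, twist s f p q != 0 -> svert x w p = svert x w q) <->
    (forall p q, f p q != 0 -> svert x w p = svert x w q).
  rewrite /twist; case: s => //; split=> H p q.
    by move=> fpq; apply/esym/H; rewrite mxE.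
  by rewrite mxE => /H.
have actT : (forall a, mact (smod k x w) a *m twist s f = twist s f *m mact (smod k x w) a) <->
    (forall a, wmx k s w a *m f = f *m wmx k s w a).
  rewrite /twist; case: s {idT} => //.
    by split=> H a; have := H a; rewrite smod_act.
  split=> H a; have := H a; rewrite smod_act -[wmx k true w a]trmxK tr_wmx /= -!trmx_mul.
    by move=> /trmx_inj.
  by move=> ->.
by split=> -[H1 H2]; split; [exact/idT/idP | exact/actT | exact/idP/idT | exact/actT].
Qed.

(* If the closed walk ends with a letter of sign s' and m is the index of its first
   letter of that sign, the string module of the walk continued by its first m
   letters has the nilpotent endomorphism b_(d+i) |-> b_i (i <= m), up to twist. *)
Lemma closed_walk_absurd x w : @brick_algebra k Q -> is_string x w -> (0 < size w)%N ->
  svert x w 0 = svert x w (size w) ->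
  (forall i j, (i < j <= size w)%N -> svert x w i = svert x w j -> i = 0%N /\ j = size w) ->
  False.
Proof.
move=> brick st d0 cl mini.
set d := size w in d0 cl mini.
have [[a1 s'] e1] : exists l, onth w d.-1 = Some l by apply: onth_ex; rewrite prednK.
set s := ~~ s'.
have s'E : s' = ~~ s by rewrite negbK.
have exm : exists m, [exists a, onth w m == Some (a, s')].
  by exists d.-1; apply/existsP; exists a1; rewrite e1.
case: (ex_minnP exm) => m /existsP[am /eqP em] mmin.
have md : (m < d)%N by exact: onth_lt em.
have fwd i a t : onth w i = Some (a, t) -> (i < m)%N -> t = s.
  move=> e lt; apply/eqP/negPn/negP => /negP ts.
  suff /mmin : [exists a, onth w i == Some (a, s')] by rewrite leqNgt lt.
  by apply/existsP; exists a; rewrite e s'E; case: t ts {e}; case: (s); rewrite ?eqxx.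
have dist i j : (i < d)%N -> (j < d)%N -> svert x w i = svert x w j -> i = j.
  move=> id jd e; case: (ltngtP i j) => // lt.
    by have [] := mini i j _ e; rewrite ?lt /=; lia.
  by have [] := mini j i _ (esym e); rewrite ?lt /=; lia.
pose u := w ++ take m w.
have szu : size u = (d + m)%N by rewrite size_cat size_take_min /=; congr addn; apply/minn_idPl; exact: ltnW.
have u1 i : (i < d)%N -> onth u i = onth w i by move=> lt; rewrite onth_cat lt.
have u2 i : (i < m)%N -> onth u (d + i) = onth w i.
  by move=> lt; rewrite onth_cat ltnNge leq_addr /= addKn onth_take lt.
have stu : is_string x u.
  apply: stringI => [l|i l l']; first by rewrite u1 //; exact: string_start.
  case: (ltnP i.+1 d) => h.
    rewrite !u1 //; [exact: (string_next st)|exact: ltnW].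
  have [id|id] := leqP d i.
    move=> e e'; move: (onth_lt e'); rewrite szu => lt; move: e e'.
    have -> : i = (d + (i - d))%N by lia.
    rewrite -addnS !u2; try lia.
    exact: (string_next st).
  have ie : i = d.-1 by lia.
  rewrite u1 // ie e1 prednK // => -[<-] e'.
  have m0 : (0 < m)%N by have := onth_lt e'; rewrite szu; lia.
  move: e'; rewrite -[d]addn0 u2 //; case: l' => [a0 t0] e0.
  have t0E := fwd _ _ _ e0 m0; subst t0.
  split=> /=.
  - rewrite -(svert_src st e0) cl -(svert_tgt x e1); congr svert; lia.
  (* If the letters at the junction cancelled, positions 1 and [d.-1] would share a vertex. This
     forces [d] to be 2, and then [w] itself is a letter followed by its inverse. *)
  - move=> [a01 _]; subst a0.
    have e : svert x w 1 = svert x w d.-1.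
      rewrite (svert_tgt x e0) (svert_src st e1) /ltgt /lsrc /= s'E.
      by case: (s).
    have d2 : (1 < d)%N by lia.
    have e' := dist _ _ d2 _ e.
    have [] := string_next st e0 (_ : onth w 1 = Some (a1, s')); first by rewrite e' //; lia.
    by move=> _ H _ _; apply: H; split=> //=; rewrite s'E; case: (s).
  - by move=> []; rewrite s'E; case: (s) => // _ [].
  - by move=> []; rewrite s'E; case: (s) => // _ [].
have v1 i : (i <= d)%N -> svert x u i = svert x w i.
  case: i => // i lt; have [l e] := onth_ex lt.
  by rewrite (svert_tgt x e); apply: svert_tgt; rewrite u1.
have v2 i : (i <= m)%N -> svert x u (d + i) = svert x w i.
  case: i => [_|i lt]; first by rewrite addn0 v1.
  have [l e] : exists l, onth w i = Some l by apply: onth_ex; apply: leq_trans lt (ltnW md).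
  by rewrite (svert_tgt x e) addnS; apply: svert_tgt; rewrite u2.
(* Only the first [m] positions after the start repeat, so a vertex recurs in [u] exactly at a shift
   by [d]. *)
have coll p q : (p <= d + m)%N -> (q <= d + m)%N -> svert x u p = svert x u q ->
    [\/ p = q, p = (d + q)%N /\ (q <= m)%N | q = (d + p)%N /\ (p <= m)%N].
  have red r : (r <= d + m)%N -> exists r', [/\ (r' < d)%N, svert x u r = svert x w r' &
      r = r' \/ r = (d + r')%N /\ (r' <= m)%N].
    move=> rm; have [lt|ge] := ltnP r d.
      by exists r; split=> //; [rewrite v1 // ltnW | left].
    exists (r - d)%N; split; [lia | | right; lia].
    by rewrite -v2 ?subnKC //; lia.
  move=> /red[p' [pd ep hp]] /red[q' [qd eq hq]] e.
  have pq := dist _ _ pd qd (etrans (esym ep) (etrans e eq)); subst q'.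
  case: hp => [hp|[hp hp']]; case: hq => [hq|[hq hq']].
  - by constructor 1; rewrite hp hq.
  - by constructor 3; rewrite hp.
  - by constructor 2; rewrite hq.
  - by constructor 1; rewrite hp hq.
have ltS p : (p <= d + m)%N -> (p < (size u).+1)%N by rewrite szu ltnS.
pose W a := wmx k s u a.
(* Commuting with [W a] transports entries: two pairs of positions joined componentwise by the same
   arrow carry equal entries. *)
have comm (N : 'M[k]_((size u).+1)) a (p r r' q : 'I_(size u).+1) : W a *m N = N *m W a ->
    walk s u a p r -> walk s u a r' q -> N r q = N p r'.
  by move=> /matrixP/(_ p q) e h h'; move: e; rewrite (wmx_mull _ _ stu h) (wmx_mulr _ _ stu h').
have letter_walk i a t (p q : 'I_(size u).+1) : onth u i = Some (a, t) ->
    p = i :> nat -> q = i.+1 :> nat -> if t == s then walk s u a p q else walk s u a q p.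
  move=> e pe qe; rewrite /walk pe qe !eqxx e /=; case: eqP => [->|ts]; first by rewrite eqxx.
  have -> : t = ~~ s by case: (t) ts; case: (s).
  by rewrite eqxx orbT.
have ul (p : 'I_(size u).+1) : (p <= d + m)%N by rewrite -szu -ltnS.
have trig (N : 'M[k]_((size u).+1)) :
    (forall p q, N p q != 0 -> svert x u p = svert x u q) ->
    (forall a, W a *m N = N *m W a) ->
    is_trig_mx N /\ forall i, N i i = N ord0 ord0.
  move=> NV NW.
  (* Entries above the diagonal can occur only at [(i, d + i)]. The one at [(0, d)] vanishes, since
     otherwise [a1] would also leave position 0 and cancel at the junction; the common letters then
     carry this zero along. *)
  have up i : (i <= m)%N -> forall p q : 'I_(size u).+1,
      p = i :> nat -> q = (d + i)%N :> nat -> N p q = 0.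
    elim: i => [|i IH] im p q pe qe.
      have lt : (d.-1 < (size u).+1)%N by apply: ltS; lia.
      have h := letter_walk d.-1 a1 s' (Ordinal lt) q.
      have {h}: walk s u a1 q (Ordinal lt).
        have : (s' == s) = false by rewrite s'E; case: (s).
        by move: h => /[swap] ->; apply=> //; [rewrite u1 ?e1 //; lia|lia].
      move=> h; have /matrixP/(_ p (Ordinal lt)) := NW a1.
      rewrite (wmx_mulr _ _ stu h) => <-; apply: wmx_mull0 => r; apply/negP.
      move=> /orP[] /andP[/eqP rp /eqP e]; last by move: rp; rewrite pe.
      rewrite pe in e.
      have e0 : onth w 0 = Some (a1, s) by rewrite -u1.
      have m0 : (0 < m)%N.
        rewrite lt0n; apply/eqP => m0; move: em; rewrite m0 e0 => -[_].
        by rewrite s'E; case: (s).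
      have [] := @string_next _ x u d.-1 (a1, s') (a1, s) stu.
      - by rewrite u1 //; lia.
      - by rewrite prednK // -[d]addn0 u2.
      - by move=> _ H _ _; apply: H; split=> //=; rewrite s'E; case: (s).
    have [[a t] e] : exists l, onth w i = Some l by apply: onth_ex; lia.
    have tE := fwd _ _ _ e im; subst t.
    have lt1 : (i < (size u).+1)%N by apply: ltS; lia.
    have lt2 : (d + i < (size u).+1)%N by apply: ltS; lia.
    rewrite -(IH (ltnW im) (Ordinal lt1) (Ordinal lt2)) //.
    apply: (comm N a) => //.
      have := letter_walk i a s (Ordinal lt1) p; rewrite eqxx; apply=> //.
      by rewrite u1 //; lia.
    by have := letter_walk (d + i)%N a s (Ordinal lt2) q; rewrite eqxx u2 //; apply=> //; lia.
  split.
    apply/is_trig_mxP => p q pq; apply/eqP/idPn => Npq.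
    case: (coll p q (ul p) (ul q) (NV _ _ Npq)) => [e|[e _]|[e le]].
    - by rewrite e ltnn in pq.
    - by move: pq; rewrite e; lia.
    - by rewrite (up p le p q) // eqxx in Npq.
  have diag i : forall p : 'I_(size u).+1, p = i :> nat -> N p p = N ord0 ord0.
    elim: i => [|i IH] p pe; first by congr (N _ _); apply: val_inj.
    have lt : (i < (size u).+1)%N by apply: ltS; have := ul p; lia.
    have [[a t] e] : exists l, onth u i = Some l by apply: onth_ex; have := ul p; lia.
    rewrite -(IH (Ordinal lt)) //.
    have := letter_walk i a t (Ordinal lt) p e erefl pe; case: ifP => _ h.
      exact: (comm N a).
    by apply/esym/(comm N a).
  by move=> p; exact: diag.
pose X := smod k x u.
have mX : is_module X by exact: smod_module.
have twK (A : 'M[k]_((size u).+1)) : twist s (twist s A) = A by rewrite /twist; case: (s); rewrite ?trmxK.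
(* Every endomorphism is, up to [twist], triangular with constant diagonal, which leaves only the
   trivial idempotents. *)
have ind : indecomposable X.
  apply: indecomposable_idem => // f hf ff.
  have [NV NW] : (forall p q, twist s f p q != 0 -> svert x u p = svert x u q) /\
      (forall a, W a *m twist s f = twist s f *m W a) by apply/smod_homP; rewrite twK.
  have [tN dN] := trig _ NV NW.
  have NN : twist s f *m twist s f = twist s f by rewrite /twist; case: (s); rewrite // -trmx_mul ff.
  rewrite -[f]twK; case: (trig_idem tN dN NN) => ->; rewrite /twist; case: (s);
    rewrite ?trmx0 ?trmx1; by [left|right].
pose N : 'M[k]_((size u).+1) := \matrix_(p, q) (val p == d + q)%N%:R.
have hN : @is_hom k Q X X (twist s N).
  apply/smod_homP; split=> [p q|a].
    rewrite mxE; case: (eqVneq (val p) (d + q)%N) => [e _|]; last by rewrite eqxx.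
    have le : (q <= m)%N by have := ul p; rewrite -[X in (X <= _)%N]/(val p) e leq_add2l.
    by rewrite -[X in svert _ _ X]/(val p) e v2 // v1 //; lia.
  have Nl p (q : 'I_(size u).+1) : (W a *m N) p q =
      ((q <= m)%N && walk s u a p (d + q)%N)%:R.
    have [le|gt] := leqP q m; last first.
      rewrite mxE big1 // => r _; rewrite [N _ _]mxE; case: eqP => [e|_]; last by rewrite mulr0.
      by have := ul r; rewrite -[X in (X <= _)%N]/(val r) e; lia.
    have lt : (d + q < (size u).+1)%N by apply: ltS; lia.
    rewrite mxE (sum_only (i := Ordinal lt)) => [|r re]; rewrite !mxE /=.
      by rewrite eqxx mulr1.
    case: (eqVneq (nat_of_ord r) (d + q)%N) => [e|_]; last by rewrite mulr0.
    by case/eqP: re; apply: val_inj.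
  have Nr (p q : 'I_(size u).+1) : (N *m W a) p q =
      ((d <= p)%N && walk s u a (p - d)%N q)%:R.
    have [le|gt] := leqP d p; last first.
      rewrite mxE big1 // => r _; rewrite mxE; case: eqP => [e|_]; last by rewrite mul0r.
      by move: gt; rewrite -[X in (X < _)%N]/(val p) e; lia.
    have lt : (p - d < (size u).+1)%N by have := ltn_ord p; lia.
    rewrite mxE (sum_only (i := Ordinal lt)) => [|r re]; rewrite !mxE /=.
      by rewrite subnKC // eqxx mul1r.
    case: (eqVneq (nat_of_ord p) (d + r)%N) => [e|_]; last by rewrite mul0r.
    by case/eqP: re; apply: val_inj; rewrite /= e addKn.
  apply/matrixP => p q; rewrite Nl Nr; congr (nat_of_bool _)%:R.
  (* The products could differ only at the two ends of the overlap: the steps from [d.-1] to [d] and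
     from [m] to [m.+1]. Both letters have sign [s'], so [walk s] does not take them in that
     direction. *)
  have [qm|qm] := leqP q m; have [dp|pd] := leqP d p => /=.
  - have pm := ul p; rewrite /walk.
    have -> : (d + q == p.+1)%N = (nat_of_ord q == (p - d).+1)%N by apply/eqP/eqP; lia.
    have -> : (val p == (d + q).+1)%N = (p - d == q.+1)%N by apply/eqP/eqP => /=; lia.
    congr (_ || _).
      case: (eqVneq (nat_of_ord q) (p - d).+1) => //= e.
      by rewrite -{1}(subnKC dp) u2 ?u1 //; lia.
    case: (eqVneq (p - d)%N q.+1) => //= e.
    by rewrite u2 ?u1 //; lia.
  - apply/negP => /orP[] /andP[/eqP h /eqP e]; last by lia.
    have pe : p = d.-1 :> nat by lia.
    move: e; rewrite pe u1 ?e1; last by lia.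
    by rewrite s'E => -[]; case: (s).
  - apply/esym/negP => /orP[] /andP[/eqP h /eqP e]; last by have := ul p; lia.
    have pe : (p - d)%N = m by have := ul p; lia.
    move: e; rewrite pe u1 // em s'E => -[_]; by case: (s).
  - by [].
have lt : (d < (size u).+1)%N by apply: ltS; lia.
have N0 : twist s N != 0.
  have N0 : N != 0.
    apply/eqP => /matrixP/(_ (Ordinal lt) ord0); rewrite !mxE /= addn0 eqxx => /eqP.
    by rewrite oner_eq0.
  by rewrite /twist; case: (s) => //; rewrite trmx_eq0.
have := brick X ind (twist s N) hN N0.
(* The first row of [N] is zero because [d] is positive. *)
have : N \notin unitmx.
  apply/negP => uN; have /matrixP/(_ ord0 ord0) := mulmxV uN.
  rewrite [RHS]mxE eqxx mxE big1 => [/esym/eqP|i _]; first by rewrite oner_eq0.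
  by rewrite mxE /= ltn_eqF ?mul0r //; lia.
by rewrite /twist; case: (s); rewrite ?unitmx_tr => /negbTE ->.
Qed.

(** By induction on the length, a repeated vertex may be assumed to occur at the two ends only,
    where [closed_walk_absurd] applies. *)
Lemma brick_thin : @brick_algebra k Q -> forall x w i j, is_string x w ->
  (i <= size w)%N -> (j <= size w)%N -> svert x w i = svert x w j -> i = j.
Proof.
move=> brick x w; move: {2}(size w) (leqnn (size w)) => n.
elim/ltn_ind: n x w => n IH x w wn.
suff H i j : is_string x w -> (i < j <= size w)%N -> svert x w i = svert x w j -> False.
  move=> i j st iw jw e; case: (ltngtP i j) => // lt.
    by case: (H i j st _ e); rewrite lt.
  by case: (H j i st _ (esym e)); rewrite lt.
(* A repetition elsewhere closes up a strictly shorter substring, which the induction hypothesis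
   excludes. *)
move=> st; have small i' j' : (i' < j' <= size w)%N -> svert x w i' = svert x w j' ->
    i' = 0%N /\ j' = size w.
  move=> /andP[ij jw] e; apply: NNPP => ne.
  have sz : size (take (j' - i') (drop i' w)) = (j' - i')%N.
    by apply: size_takel; rewrite size_drop; lia.
  have lt : (j' - i' < n)%N by lia.
  have := IH _ lt (svert x w i') (take (j' - i') (drop i' w)) _ 0%N (j' - i')%N.
  rewrite sz => /(_ (leqnn _)) H.
  have [] : 0%N <> (j' - i')%N by lia.
  apply: H => //; first by apply: substring => //; lia.
  by rewrite !svert_sub //; try lia; rewrite addn0 subnKC // ltnW.
move=> ij e; have [i0 jd] := small i j ij e; subst i j.
by apply: (closed_walk_absurd brick st _ e small); case/andP: ij.
Qed.

End ClosedWalk.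

(** * Specialization of strings, and the bijection *)

Definition spec_string (Q : bquiver) (p : vtx Q * seq (letter (piQ Q))) : Prop :=
  is_string (Q := piQ Q) p.1 p.2 /\ is_string (Q := Q) p.1 (map (@spec Q) p.2).

(** Replacing a starred arrow by an inverse letter keeps its source and target, so a string and its
    specialization visit the same vertices. *)
Lemma svert_spec (Q : bquiver) x (w : seq (letter (piQ Q))) j :
  svert (Q := Q) x (map (@spec Q) w) j = svert (Q := piQ Q) x w j.
Proof.
rewrite /svert -map_comp; congr (nth _ (_ :: _) _).
by apply: eq_map => -[[a|a] []].
Qed.

Lemma spec_substring (Q : bquiver) x (w : seq (letter (piQ Q))) p n :
  @spec_string Q (x, w) -> (p <= size w)%N ->
  @spec_string Q (svert (Q := piQ Q) x w p, take n (drop p w)).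
Proof.
move=> [/= s1 s2] pw; split=> /=; first exact: substring.
by rewrite map_take map_drop -svert_spec; apply: substring; rewrite ?size_map.
Qed.

Theorem theorem7p3 (k : fieldType) (Q : bquiver) :
  gentle Q -> @brick_algebra k Q ->
  exists f : {P | @torshad k Q P} -> {P | @widshad k Q P}, bijective f.
Proof.
move=> _ brick.
(* The brick hypothesis concerns [A], so distinctness of vertices is read off from the specialized
   string. *)
have thin (x : vtx (piQ Q)) w i j : @spec_string Q (x, w) -> (i <= size w)%N -> (j <= size w)%N ->
    svert x w i = svert x w j -> i = j.
  move=> [/= _ st] iw jw; rewrite -!svert_spec.
  by apply: (brick_thin brick st); rewrite size_map.
apply: (@shadows_bijection k (piQ Q) (vtx Q * seq (letter (piQ Q)))%type
          (fun p => @smod k (piQ Q) p.1 p.2) (@spec_string Q) _ _ #|vtx Q| _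
          (thin_ker_in_add (Q := piQ Q) (@spec_substring Q) thin)
          (thin_im_in_add (Q := piQ Q) (@spec_substring Q) thin)
          (thin_coker_in_add (Q := piQ Q) (@spec_substring Q) thin)) => [p [s _]||[x w] Bw] //=.
  exact: smod_module.
(* Positions inject into vertices, which bounds dimensions by the number of vertices. *)
rewrite -(card_ord (size w).+1).
rewrite -(card_codom (f := fun i : 'I_(size w).+1 => svert (Q := piQ Q) x w i)); first exact: max_card.
by move=> i j /(thin _ _ _ _ Bw) e; apply: val_inj; apply: e; rewrite -ltnS.
Qed.
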